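(* Let $0<\varepsilon<1$, $0<\delta<1$, $\zeta>0$ and $\rho>0$. Let $\gamma_1<\gamma_2<\cdots<\gamma_s$ be the ascending arrangement of all distinct elements of $$\left\{\left\lceil\left[\frac32\left(\frac1\varepsilon+1\right)\right]^{\frac i\tau}\frac{4(3+\varepsilon)}{9\varepsilon}\ln\frac1{\zeta\delta}\right\rceil:i=0,1,\ldots,\tau\right\},\qquad \tau=\left\lceil\frac{\ln\left[\frac32\left(\frac1\varepsilon+1\right)\right]}{\ln(1+\rho)}\right\rceil .$$ Let $\widehat p_\ell=\frac{1}{\mathbf n_\ell}\sum_{i=1}^{\mathbf n_\ell}X_i$, where $\mathbf n_\ell$ is the minimum number of samples such that $\sum_{i=1}^{\mathbf n_\ell}X_i=\gamma_\ell$. For $\ell=1,\ldots,s$ let $z_\ell=1+\frac{2\varepsilon}{3+\varepsilon}+\frac{9\varepsilon^2\gamma_\ell}{2(3+\varepsilon)^2\ln(\zeta\delta)}$, and let $D_\ell=1$ if $\widehat p_\ell\ge z_\ell$ and $D_\ell=0$ otherwise. Sampling is continued until $D_\ell=1$ for some $\ell\in\{1,\ldots,s\}$. Let $\mathbf n$ be the sample size when sampling is terminated and $\widehat p=\frac1{\mathbf n}\sum_{i=1}^{\mathbf n}X_i$. Then $$\Pr\left\{\left|\frac{\widehat p-p}{p}\right|\le\varepsilon\,\Big|\,p\right\}\ge1-\delta\qquad\text{for every }p\in(0,1),$$ provided that $\zeta>0$ is sufficiently small to guarantee $g(\varepsilon,\gamma_s)<\delta$ and $$\ln(\zeta\delta)<\left[\frac{\left(1+\varepsilon+\sqrt{1+4\varepsilon+\varepsilon^2}\right)^2}{4\varepsilon^2}+\frac12\right]\left[\frac{\varepsilon}{1+\varepsilon}-\ln(1+\varepsilon)\right],$$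 $$\sum_{\ell=1}^s\Pr\{\widehat p_\ell\le(1-\varepsilon)p,\ D_{\ell-1}=0,\ D_\ell=1\mid p\}\le\frac\delta2\quad\forall p\in\mathscr Q_r^-,$$ $$\sum_{\ell=1}^s\Pr\{\widehat p_\ell\ge(1+\varepsilon)p,\ D_{\ell-1}=0,\ D_\ell=1\mid p\}\le\frac\delta2\quad\forall p\in\mathscr Q_r^+,$$ where $\mathscr Q_r^+=\bigcup_{\ell=1}^s\left\{\frac{\gamma_\ell}{m(1+\varepsilon)}\in(p^*,1):m\in\mathbb N\right\}$ and $\mathscr Q_r^-=\bigcup_{\ell=1}^s\left\{\frac{\gamma_\ell}{m(1-\varepsilon)}\in(p^*,1):m\in\mathbb N\right\}$, with $p^*\in(0,z_{s-1})$ denoting the unique number satisfying $$g(\varepsilon,\gamma_s)+\sum_{\ell=1}^{s-1}\exp\left(\frac{\gamma_\ell}{z_\ell}\,\frac{(p^*-z_\ell)^2}{2\left(\frac{2p^*}{3}+\frac{z_\ell}{3}\right)\left(\frac{2p^*}{3}+\frac{z_\ell}{3}-1\right)}\right)=\delta .$$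
   Context: $X_1,X_2,\ldots$ are i.i.d. Bernoulli random variables with $\Pr\{X_i=1\}=1-\Pr\{X_i=0\}=p\in(0,1)$; $\Pr\{\cdot\mid p\}$ denotes probability when the Bernoulli parameter is $p$. $\mathbb N$ is the set of positive integers and $\lceil x\rceil$ is the smallest integer not less than $x$. By convention $D_0=0$. Sampling stops at the smallest index $\ell\ge1$ with $D_\ell=1$, and then $\mathbf n=\mathbf n_\ell$ and $\widehat p=\widehat p_\ell$. For $0<\varepsilon<1$ and a positive integer $\gamma$, $$g(\varepsilon,\gamma)=1-\sum_{i=0}^{\gamma-1}\frac1{i!}\left(\frac{\gamma}{1+\varepsilon}\right)^i\exp\left(-\frac{\gamma}{1+\varepsilon}\right)+\sum_{i=0}^{\gamma-1}\frac1{i!}\left(\frac{\gamma}{1-\varepsilon}\right)^i\exp\left(-\frac{\gamma}{1-\varepsilon}\right).$$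
   Formalization: Existence of p* is assumed (its uniqueness is proved): the conditions on ζ do not imply it, e.g. for ε=0.9, ρ=0.5, ζδ=0.05 and δ exceeding g(ε,γ_s)≈0.0072 by less than 10⁻⁶, the equation has no solution in (0,z_{s-1}). *)

(* Defs.v *)
From HB Require Import structures.
From mathcomp Require Import all_boot all_order all_algebra.
From mathcomp Require Import all_classical all_reals all_analysis.

Set Implicit Arguments.
Unset Strict Implicit.
Unset Printing Implicit Defensive.

Import Order.TTheory GRing.Theory Num.Theory.
Import numFieldNormedType.Exports.

Local Open Scope classical_set_scope.
Local Open Scope ring_scope.

(* The samples X_1, X_2, ... are X 0, X 1, ..., as boolean random variables
   (true for a success); booleans are coerced to 0/1 in sums. *)

(* Mutual independence: the product rule over every finite subfamily. *)
Definition mutually_independent d (T : measurableType d) (R : realType)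
    (P : probability T R) (X : nat -> {mfun T >-> bool}) : Prop :=
  forall (J : seq nat) (A : nat -> set bool), uniq J ->
    P (\bigcap_(i in [set` J]) (X i @^-1` A i)) =
    (\prod_(i <- J) P (X i @^-1` A i))%E.

Definition iid_bernoulli d (T : measurableType d) (R : realType)
    (P : probability T R) (X : nat -> {mfun T >-> bool}) (p : R) : Prop :=
  mutually_independent P X /\
  forall i, P (X i @^-1` [set true]) = p%:E /\
            P (X i @^-1` [set false]) = (1 - p)%:E.

Section numerical_quantities.
Context {R : realType}.

Definition g (eps : R) (gam : nat) : R :=
  1 - \sum_(i < gam) (i`!%:R)^-1 * (gam%:R / (1 + eps)) ^+ i *
        expR (- (gam%:R / (1 + eps)))
    + \sum_(i < gam) (i`!%:R)^-1 * (gam%:R / (1 - eps)) ^+ i *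
        expR (- (gam%:R / (1 - eps))).

Definition ratio_max (eps : R) : R := 3 / 2 * (eps^-1 + 1).

Definition tau (eps rho : R) : nat :=
  `|Num.ceil (ln (ratio_max eps) / ln (1 + rho))|%N.

(* The ceilings below are positive whenever zeta * delta < 1, so that taking
   the absolute value is only a cast from int to nat. *)
Definition threshold (eps delta zeta rho : R) (i : nat) : nat :=
  `|Num.ceil (ratio_max eps `^ (i%:R / (tau eps rho)%:R) *
              (4 * (3 + eps) / (9 * eps)) * ln ((zeta * delta)^-1))|%N.

Definition gammas (eps delta zeta rho : R) : seq nat :=
  sort leq (undup [seq threshold eps delta zeta rho i
                  | i <- iota 0 (tau eps rho).+1]).

Definition stages (eps delta zeta rho : R) : nat :=
  size (gammas eps delta zeta rho).

(* Stages are numbered l = 1, ..., s. *)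
Definition gamma_ (eps delta zeta rho : R) (l : nat) : nat :=
  nth 0%N (gammas eps delta zeta rho) l.-1.

Definition z_ (eps delta zeta rho : R) (l : nat) : R :=
  1 + 2 * eps / (3 + eps) +
  9 * eps ^+ 2 * (gamma_ eps delta zeta rho l)%:R /
    (2 * (3 + eps) ^+ 2 * ln (zeta * delta)).

(* The left-hand side, as a function of q, of the equation defining p^*. *)
Definition pstar_lhs (eps delta zeta rho q : R) : R :=
  let s := stages eps delta zeta rho in
  g eps (gamma_ eps delta zeta rho s) +
  \sum_(1 <= l < s)
    let gam : R := (gamma_ eps delta zeta rho l)%:R in
    let z := z_ eps delta zeta rho l in
    let m := 2 * q / 3 + z / 3 in
    expR (gam / z * ((q - z) ^+ 2 / (2 * m * (m - 1)))).

Definition is_pstar (eps delta zeta rho q : R) : Prop :=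
  0 < q < z_ eps delta zeta rho (stages eps delta zeta rho).-1 /\
  pstar_lhs eps delta zeta rho q = delta.

(* Q_r^+ for c = 1 + eps, and Q_r^- for c = 1 - eps. *)
Definition Qr (eps delta zeta rho pstar c : R) : set R :=
  \bigcup_(l in [set l | (1 <= l <= stages eps delta zeta rho)%N])
    [set q | pstar < q < 1 /\
       exists2 m : nat, (0 < m)%N &
         q = (gamma_ eps delta zeta rho l)%:R / (m%:R * c)].

End numerical_quantities.

Section sampling_scheme.
Context {d : measure_display} {T : measurableType d} {R : realType}.
Variable X : nat -> {mfun T >-> bool}.

Definition successes (n : nat) (w : T) : nat := \sum_(i < n) X i w.

Definition sample_mean (n : nat) (w : T) : R := (successes n w)%:R / n%:R.

(* The minimum number of samples giving k successes. On the null event where k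
   successes never occur the value is 0, and the sample mean is then 0. *)
Definition sample_size (k : nat) (w : T) : nat :=
  if pselect (exists n, successes n w == k) is left h then ex_minn h else 0%N.

Definition phat_ (eps delta zeta rho : R) (l : nat) (w : T) : R :=
  sample_mean (sample_size (gamma_ eps delta zeta rho l) w) w.

(* D_0 = 0 by convention. *)
Definition D_ (eps delta zeta rho : R) (l : nat) (w : T) : bool :=
  (0 < l)%N && (z_ eps delta zeta rho l <= phat_ eps delta zeta rho l w).

(* The smallest l in {1, ..., s} with D_l = 1 (and s + 1 if there is none). *)
Definition stop_stage (eps delta zeta rho : R) (w : T) : nat :=
  (find (fun l => D_ eps delta zeta rho l w)
        (iota 1 (stages eps delta zeta rho))).+1.

Definition stop_size (eps delta zeta rho : R) (w : T) : nat :=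
  sample_size (gamma_ eps delta zeta rho (stop_stage eps delta zeta rho w)) w.

Definition phat (eps delta zeta rho : R) (w : T) : R :=
  sample_mean (stop_size eps delta zeta rho w) w.

End sampling_scheme.

(* Main.v *)
(* If p <= p^*, an error requires stopping before stage s or an error of the
   stage-s estimate.  The former is controlled by Chernoff's bound in Massart's
   form, which increases with p; the latter by comparison with a Poisson law of
   the two binomial tails that describe n_s, legitimate because gamma_s is at
   least ((1 + eps) / eps)^2.  At p = p^* the sum of these bounds is delta.

   If p > p^*, a sample path that stops with an underestimate phat <= q <= p has
   likelihood p^gamma (1 - p)^(n - gamma), which increases when p is lowered to
   q; symmetrically for overestimates.  Hence each error probability is at most
   its value at the nearest point of Q_r^- to the left or of Q_r^+ to the right
   of p.  If Q_r^- has no point in (p^*, p), then an underestimate is below p^*,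
   hence below z_1, ..., z_(s-1), so it can only occur at stage s; there its
   probability is at most the lower Poisson tail in g, which is the smaller of
   the two tails and so is less than delta / 2. *)

Require Import Defs.
From HB Require Import structures.
From mathcomp Require Import all_boot all_order all_algebra.
From mathcomp Require Import all_classical all_reals all_analysis.
From mathcomp Require Import ring lra zify.

Set Implicit Arguments.
Unset Strict Implicit.
Unset Printing Implicit Defensive.

Import Order.TTheory GRing.Theory Num.Theory.
Import numFieldNormedType.Exports.

Local Open Scope classical_set_scope.
Local Open Scope ring_scope.

(** * Derivatives and logarithmic inequalities *)

(** The condition on [ln (zeta * delta)] serves to make gamma_s large. Its bracket is at least ((1 +
    eps) / eps)^2; with a rational lower bound for ln (1 + eps) - eps / (1 + eps) this bounds - ln
    (zeta delta) from below, and the factor 3/2 (1/eps + 1) 4 (3 + eps) / (9 eps) of the last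
    threshold cancels all but ((1 + eps) / eps)^2. Then gamma_s / (1 + eps) and gamma_s / (1 - eps)
    lie at least sqrt gamma_s away from gamma_s, which is what lets binomial weights be bounded by
    Poisson weights uniformly in p.

    Sample sizes are unbounded and may even be undefined. Yet for c > 0, phat_l >= c only says that
    gamma_l successes occur among the first floor (gamma_l / c) samples, so every probability can be
    computed on words of a fixed length. At that full length the likelihoods under two parameters
    need not be ordered; they are compared at the prefix where the event is decided. *)

Section derivatives.
Context {R : realType}.
Implicit Types (f h : R -> R) (x a b : R).

Lemma is_derive1D f h x a b : is_derive x 1 f a -> is_derive x 1 h b ->
  is_derive x 1 (fun y => f y + h y) (a + b).
Proof. by move=> fa hb; exact: is_deriveD. Qed.

Lemma is_derive1N f x a : is_derive x 1 f a -> is_derive x 1 (fun y => - f y) (- a).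
Proof. by move=> fa; exact: is_deriveN. Qed.

Lemma is_derive1M f h x a b : is_derive x 1 f a -> is_derive x 1 h b ->
  is_derive x 1 (fun y => f y * h y) (f x * b + h x * a).
Proof. by move=> fa hb; exact: is_deriveM. Qed.

Lemma is_derive1V f x a : f x != 0 -> is_derive x 1 f a ->
  is_derive x 1 (fun y => (f y)^-1) (- a / f x ^+ 2).
Proof.
move=> fx0 fa; have := is_deriveV fx0 fa.
by rewrite /GRing.scale /= mulNr mulrC -mulNr.
Qed.

Lemma is_derive1X f n x a : is_derive x 1 f a ->
  is_derive x 1 (fun y => f y ^+ n) (n%:R * f x ^+ n.-1 * a).
Proof.
have -> : (fun y => f y ^+ n) = f ^+ n.
  elim: n => [|n IHn]; first by apply/funext => y; rewrite expr0.
  by rewrite [RHS]exprS -IHn; apply/funext => y; rewrite exprS.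
by move=> fa; exact: is_deriveX.
Qed.

Lemma is_derive1_ln_fun f x a : 0 < f x -> is_derive x 1 f a ->
  is_derive x 1 (fun y => ln (f y)) (a / f x).
Proof.
move=> fx0 fa; have := is_derive1_ln fx0 => lnfx.
by rewrite mulrC; exact: (@is_derive1_comp _ (@ln R) f).
Qed.

Lemma is_derive1_expR_fun f x a : is_derive x 1 f a ->
  is_derive x 1 (fun y => expR (f y)) (expR (f x) * a).
Proof. by move=> fa; exact: (@is_derive1_comp _ expR f). Qed.

Lemma is_derive1_eq f x a b : is_derive x 1 f a -> a = b -> is_derive x 1 f b.
Proof. by move=> fa <-. Qed.

Lemma derivative_ge0_le f f' a b : a <= b ->
  (forall x, a <= x <= b -> is_derive x 1 f (f' x)) ->
  (forall x, a <= x <= b -> 0 <= f' x) -> f a <= f b.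
Proof.
move=> ab df f'0.
have [x||x xab fba] := @MVT_segment R f f' a b ab.
- by rewrite in_itv /= => /andP[ax xb]; apply: df; rewrite !ltW.
- apply: derivable_within_continuous => x; rewrite in_itv /= => xab.
  by case: (df x xab).
- rewrite -subr_ge0 fba mulr_ge0 ?subr_ge0 //; apply: f'0.
  by move: xab; rewrite in_itv.
Qed.

End derivatives.

(** Syntax-directed differentiation: the rules build the derivative into an existential variable,
    and only the side conditions of [ln] and of inverses remain. *)
Ltac derive_by_rules := lazymatch goal with
  | |- is_derive _ _ (fun y => y) _ => exact: is_derive_id
  | |- is_derive _ _ (fun _ => ?c) _ => exact: is_derive_cst
  | |- is_derive _ _ (fun y => - @?f y) _ =>
      notypeclasses refine (@is_derive1N _ f _ _ _); derive_by_rules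
  | |- is_derive _ _ (fun y => @?f y + @?h y) _ =>
      notypeclasses refine (@is_derive1D _ f h _ _ _ _ _); derive_by_rules
  | |- is_derive _ _ (fun y => @?f y * @?h y) _ =>
      notypeclasses refine (@is_derive1M _ f h _ _ _ _ _); derive_by_rules
  | |- is_derive _ _ (fun y => (@?f y)^-1) _ =>
      notypeclasses refine (@is_derive1V _ f _ _ _ _); [|derive_by_rules]
  | |- is_derive _ _ (fun y => @?f y ^+ ?n) _ =>
      notypeclasses refine (@is_derive1X _ f n _ _ _); derive_by_rules
  | |- is_derive _ _ (fun y => ln (@?f y)) _ =>
      notypeclasses refine (@is_derive1_ln_fun _ f _ _ _ _); [|derive_by_rules]
  | |- is_derive _ _ (fun y => expR (@?f y)) _ =>
      notypeclasses refine (@is_derive1_expR_fun _ f _ _ _); derive_by_rules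
  end.

(* [notypeclasses], because instance search would otherwise solve these goals
   with derivatives in a form unsuitable for [field]. *)
Ltac derive_eq := notypeclasses refine (@is_derive1_eq _ _ _ _ _ _ _).

Section log_inequalities.
Context {R : realType}.
Implicit Types (t x y z p e : R).

(** Midpoint rule for the convex function 1/x: with t = h/a it reads ln ((a + h) / (a - h)) >= 2h/a.
    Used for (a, h) = (c + 1/2, 1/2) and (c - 1, 1). *)
Lemma ln_ratio_ge t : 0 <= t < 1 -> 2 * t <= ln (1 + t) - ln (1 - t).
Proof.
move=> /andP[t0 t1].
pose F x := ln (1 + x) - ln (1 - x) - 2 * x.
suff : F 0 <= F t by rewrite /F !(addr0, subr0, mulr0, subrr) subr_ge0.
apply: (@derivative_ge0_le _ F (fun x => 2 * x ^+ 2 / ((1 - x) * (1 + x)))) => //.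
  move=> x xt; rewrite /F; derive_eq; first by derive_by_rules => /=; lra.
  by rewrite /=; field; apply/andP; split; lra.
move=> x xt; apply: divr_ge0; first by rewrite mulr_ge0 // sqr_ge0.
by apply: mulr_ge0; lra.
Qed.

(** Both sides agree at 0 up to third order. The factor 3 + e is meant to cancel the one in the
    thresholds. *)
Lemma ln1D_ge e : 0 <= e ->
  3 * e ^+ 2 / (2 * (3 + e) * (1 + e)) <= ln (1 + e) - e / (1 + e).
Proof.
move=> e0.
pose F x := ln (1 + x) - x / (1 + x) - 3 * x ^+ 2 / (2 * (3 + x) * (1 + x)).
suff : F 0 <= F e.
  by rewrite /F !(addr0, subr0, mulr0, mul0r, subrr, expr2, ln1) subr_ge0.
apply: (@derivative_ge0_le _ F
  (fun x => x ^+ 3 / ((3 + x) ^+ 2 * (1 + x) ^+ 2))) => //.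
  move=> x /andP[x0 _]; have x1 : 0 < 1 + x by lra.
  have x3 : 0 < 3 + x by lra.
  rewrite /F; derive_eq.
    by derive_by_rules => //=; rewrite ?mulf_neq0 ?lt0r_neq0.
  by rewrite /=; field; rewrite !lt0r_neq0.
move=> x /andP[x0 _]; apply: divr_ge0; first exact: exprn_ge0.
by apply: mulr_ge0; exact: sqr_ge0.
Qed.

End log_inequalities.

(** * Binomial and Poisson tails *)

Section binomial_poisson_ratio.
Context {R : realType}.
Implicit Types (m K : nat) (c w x lam : R).

Lemma natrB_ge1 m K : (m < K)%N -> 1 <= K%:R - m%:R :> R.
Proof. by move=> mK; rewrite lerBrDr nat1r ler_nat. Qed.

(* The trapezoidal rule underestimates the integral of the concave function
   [ln (1 - x / K)] over [0, m], which gives the closed form on the right. *)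
Lemma sum_ln_falling_le m K (c := K%:R - m%:R : R) : (m < K)%N ->
  \sum_(j < m) ln (1 - j.+1%:R / K%:R : R) <=
    - (c - 1 / 2) * (ln c - ln K%:R) - m%:R.
Proof.
rewrite {}/c; elim: m => [|m IHm] mK.
  by rewrite big_ord0 !subr0 subrr mulr0.
rewrite big_ord_recr /=; set c := K%:R - m.+1%:R : R.
have c1 : 1 <= c by exact: natrB_ge1.
have cE : K%:R - m%:R = c + 1 by rewrite /c -natr1; ring.
have K0 : 0 < K%:R :> R by rewrite ltr0n; lia.
have lncE : ln (1 - m.+1%:R / K%:R) = ln c - ln K%:R :> R.
  by rewrite -ln_div ?posrE //; [congr ln; rewrite /c; field; lra | lra].
have := IHm (ltnW mK); rewrite cE lncE => IH.
have t01 : 0 <= (2 * c + 1)^-1 < 1.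
  by apply/andP; split; [rewrite invr_ge0; lra | rewrite invf_lt1; lra].
have := ln_ratio_ge t01.
have -> : 1 + (2 * c + 1)^-1 = (c + 1) / (c + 1 / 2) by field; lra.
have -> : 1 - (2 * c + 1)^-1 = c / (c + 1 / 2) by field; lra.
rewrite !ln_div ?posrE; [|lra..] => h.
have : 1 <= (c + 1 / 2) * (ln (c + 1) - ln c).
  have c2 : 0 <= c + 1 / 2 by lra.
  apply: le_trans (ler_wpM2l c2 (le_trans h _)); last lra.
  by rewrite le_eqVlt; apply/orP; left; apply/eqP; field; lra.
have -> : m.+1%:R = m%:R + 1 :> R by rewrite natr1.
by nra.
Qed.

(** With c = K - m and w = m - lam, this bounds the logarithm of the left-hand side of
    [binomial_poisson_ratio_le1], once K is replaced by c + w^2 + 2w, the largest value compatible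
    with m + 1 <= (w + 1)^2. Since m >= 0, that condition leaves only w >= 0 or w <= -2. *)
Let psi c w :=
  (c - 1) * (ln (c + w) - ln c) + (ln (c + (w ^+ 2 + 2 * w)) - ln c) / 2 - w.

Lemma psi_le0_pos c w : 1 <= c -> 0 <= w -> psi c w <= 0.
Proof.
move=> c1 w0; pose F x := - psi c x.
suff : F 0 <= F w by rewrite /F /psi expr2 !(mul0r, mulr0, addr0, subrr); lra.
apply: (@derivative_ge0_le _ F (fun x => (x + 1) *
  ((c + x)^-1 - (c + (x ^+ 2 + 2 * x))^-1)) 0 w w0).
  move=> x /andP[x0 _]; rewrite /F /psi; have x2 := sqr_ge0 x.
  have p1 : 0 < c + x by lra.
  have p2 : 0 < c + (x ^+ 2 + 2 * x) by lra.
  derive_eq; first by derive_by_rules; [exact: p1 | exact: p2].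
  by rewrite /=; field; rewrite (lt0r_neq0 p1) (lt0r_neq0 p2).
move=> x /andP[x0 _]; apply: mulr_ge0; first lra.
have x2 := sqr_ge0 x.
by rewrite subr_ge0 lef_pV2 ?posrE; lra.
Qed.

Lemma psi_le0_neg c w : w <= -2 -> 0 < c + w -> psi c w <= 0.
Proof.
move=> w2 cw.
(* On this side [psi c] increases, so w = -2 is the worst case; there the claim is ln (c / (c - 2))
   >= 2 / (c - 1). *)
apply: le_trans (_ : psi c (-2) <= 0); last first.
  rewrite /psi; have -> : (-2) ^+ 2 + 2 * -2 = 0 :> R by ring.
  rewrite addr0 subrr mul0r addr0.
  have t01 : 0 <= (c - 1)^-1 < 1.
    by apply/andP; split; [rewrite invr_ge0; lra | rewrite invf_lt1; lra].
  have := ln_ratio_ge t01.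
  have -> : 1 + (c - 1)^-1 = c / (c - 1) by field; lra.
  have -> : 1 - (c - 1)^-1 = (c - 2) / (c - 1) by field; lra.
  rewrite !ln_div ?posrE; [|lra..]; rewrite ler_pdivrMr; last lra.
  by nra.
apply: (@derivative_ge0_le _ (psi c) (fun x => - (x + 1) *
  ((c + x)^-1 - (c + (x ^+ 2 + 2 * x))^-1)) w (-2) w2).
  move=> x /andP[xw x2]; rewrite /psi.
  have p1 : 0 < c + x by lra.
  have p2 : 0 < c + (x ^+ 2 + 2 * x) by nra.
  derive_eq; first by derive_by_rules; [exact: p1 | exact: p2].
  by rewrite /=; field; rewrite (lt0r_neq0 p1) (lt0r_neq0 p2).
move=> x /andP[xw x2]; apply: mulr_ge0; first lra.
by rewrite subr_ge0 lef_pV2 ?posrE; nra.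
Qed.

(** With p = lam / K, the left-hand side is the ratio to a Poisson(lam) weight of two binomial
    weights at once: of K - 1 trials at m, and of K trials at m + 1. The first use gives lower
    tails, the second upper tails. *)
Lemma binomial_poisson_ratio_le1 m K lam : (m < K)%N -> 0 <= lam < K%:R ->
  m.+1%:R <= (lam - m.+1%:R) ^+ 2 ->
  \prod_(j < m) (1 - j.+1%:R / K%:R) * (1 - lam / K%:R) ^+ (K.-1 - m) *
    expR lam <= 1.
Proof.
move=> mK /andP[lam0 lamK] hlam.
have K0 : 0 < K%:R :> R by lra.
set c := K%:R - m%:R : R; set w : R := m%:R - lam.
have c1 : 1 <= c by exact: natrB_ge1.
have cw : 0 < c + w by rewrite /c /w; lra.
have fac0 (j : 'I_m) : 0 < 1 - j.+1%:R / K%:R :> R.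
  rewrite subr_gt0 ltr_pdivrMr // mul1r ltr_nat.
  by apply: leq_ltn_trans mK; exact: ltn_ord.
have bK : 0 < 1 - lam / K%:R by rewrite subr_gt0 ltr_pdivrMr // mul1r.
have prodE : \prod_(j < m) (1 - j.+1%:R / K%:R) =
    expR (\sum_(j < m) ln (1 - j.+1%:R / K%:R)) :> R.
  by rewrite expR_sum; apply: eq_bigr => j _; rewrite lnK ?posrE.
rewrite prodE -[X in X ^+ _]lnK ?posrE // -expRM_natl -!expRD -[leRHS]expR0 ler_expR.
have -> : (K.-1 - m)%:R = c - 1 :> R.
  by rewrite /c -subn1 -subnDA natrB ?natrD; [lra | lia].
have -> : ln (1 - lam / K%:R) = ln (c + w) - ln K%:R.
  by rewrite -ln_div ?posrE //; congr ln; rewrite /c /w; field; lra.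
have S_le := @sum_ln_falling_le m K mK; rewrite -/c in S_le.
have w1 : m%:R + 1 <= (w + 1) ^+ 2.
  have -> : w + 1 = - (lam - m.+1%:R) by rewrite /w -natr1; ring.
  by rewrite sqrrN natr1.
have m0 : 0 <= m%:R :> R by [].
have lnK_le : ln K%:R <= ln (c + (w ^+ 2 + 2 * w)).
  by rewrite ler_ln ?posrE; rewrite /c; nra.
have : psi c w <= 0.
  have [w0|w0] := lerP 0 (w + 1); first by apply: psi_le0_pos => //; nra.
  by apply: psi_le0_neg => //; nra.
rewrite /psi.
have lamE : lam = m%:R - w by rewrite /w; ring.
rewrite lamE; nra.
Qed.

End binomial_poisson_ratio.

(** * The Poisson distribution function as a function of its mean *)

Section poisson_tails.
Context {R : realType}.
Implicit Types (gam n m i : nat) (x y p : R).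

Definition poisson_cdf gam x : R :=
  \sum_(i < gam) (i`!%:R)^-1 * x ^+ i * expR (- x).

Definition binomial_cdf gam n p : R :=
  \sum_(i < gam) 'C(n, i)%:R * p ^+ i * (1 - p) ^+ (n - i).

(** The derivatives of the terms telescope to minus a gamma density: [poisson_cdf gam.+1] is the
    survival function of the gamma law of shape gam + 1. *)
Lemma is_derive_poisson_cdf gam x :
  is_derive x 1 (poisson_cdf gam.+1) (- ((gam`!%:R)^-1 * x ^+ gam * expR (- x))).
Proof.
elim: gam => [|gam IHgam].
  have -> : poisson_cdf 1 = fun y => expR (- y).
    by apply/funext => y; rewrite /poisson_cdf big_ord1 /= fact0 invr1 !mul1r.
  derive_eq; first by derive_by_rules.
  by rewrite fact0 invr1 !mul1r mulrN1.
have -> : poisson_cdf gam.+2 =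
    fun y => poisson_cdf gam.+1 y + (gam.+1`!%:R)^-1 * y ^+ gam.+1 * expR (- y).
  by apply/funext => y; rewrite /poisson_cdf big_ord_recr.
derive_eq.
  notypeclasses refine (@is_derive1D _ (poisson_cdf gam.+1) _ _ _ _ IHgam _).
  by derive_by_rules.
have f0 : gam`!%:R != 0 :> R by rewrite pnatr_eq0 -lt0n fact_gt0.
have g0 : gam%:R + 1 != 0 :> R by rewrite natr1 pnatr_eq0.
rewrite /= factS natrM -!natr1 exprS; field.
by rewrite f0 g0.
Qed.

Lemma poisson_cdf_nonincreasing gam x y : 0 <= x -> x <= y ->
  poisson_cdf gam y <= poisson_cdf gam x.
Proof.
case: gam => [|gam] x0 xy; first by rewrite /poisson_cdf !big_ord0.
rewrite -lerN2; apply: (@derivative_ge0_le _ (fun z => - poisson_cdf gam.+1 z)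
  (fun z => (gam`!%:R)^-1 * z ^+ gam * expR (- z)) x y xy).
  move=> z _; rewrite -[X in is_derive _ _ _ X]opprK.
  exact: is_derive1N (is_derive_poisson_cdf gam z).
move=> z /andP[xz _]; rewrite !mulr_ge0 ?invr_ge0 ?expR_ge0 ?exprn_ge0 //.
exact: le_trans xz.
Qed.

Lemma poisson_cdf_le1 gam x : 0 <= x -> poisson_cdf gam x <= 1.
Proof.
move=> x0; apply: le_trans (poisson_cdf_nonincreasing gam (lexx 0) x0) _.
case: gam => [|gam]; first by rewrite /poisson_cdf big_ord0.
rewrite /poisson_cdf big_ord_recl big1 ?addr0 => [|i _].
  by rewrite /= fact0 expr0 oppr0 expR0 invr1 !mul1r.
by rewrite exprS mul0r mulr0 mul0r.
Qed.

(** A crude decay at infinity, which replaces a limit argument in the reflection lemma. *)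
Lemma poisson_cdf_le_inv gam x : 0 < x ->
  poisson_cdf gam x <= gam%:R * (gam%:R / x).
Proof.
move=> x0; apply: le_trans (_ : _ <= \sum_(i < gam) gam%:R / x) _; last first.
  by rewrite sumr_const card_ord -[leLHS]mulr_natl.
apply: ler_sum => i _.
have f0 : 0 < i`!%:R :> R by rewrite ltr0n fact_gt0.
have := expR_ge1Dxn i (ltW x0); rewrite factS natrM => h.
have {}h : x ^+ i.+1 / (i.+1%:R * i`!%:R) <= expR x.
  by apply: le_trans h; rewrite lerDr.
rewrite expRN ler_pdivlMr // mulrAC ler_pdivrMr ?expR_gt0 //.
apply: le_trans (_ : _ <= i.+1%:R * expR x) _; last first.
  by rewrite ler_wpM2r ?expR_ge0 // ler_nat.
rewrite -ler_pdivrMl ?ltr0n //; apply: le_trans h.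
rewrite exprS le_eqVlt; apply/orP; left; apply/eqP; field.
by rewrite lt0r_neq0 //= pnatr_eq0.
Qed.

(* [ln] of a gamma variable has density proportional to [exp (gam (u - e^u))],
   and [u - e^u] is smaller at [u] than at [- u]: reflecting [u] shows that
   the mass below [ln y] exceeds the mass above [- ln y]. *)
Lemma poisson_cdf_reflect gam y : 0 < y <= 1 ->
  poisson_cdf gam.+1 (gam.+1%:R / y) <= 1 - poisson_cdf gam.+1 (gam.+1%:R * y).
Proof.
move=> /andP[y0 y1]; set N := gam.+1%:R : R.
have N0 : 0 < N by rewrite ltr0n.
have f0 : 0 < gam`!%:R :> R by rewrite ltr0n fact_gt0.
(* The claim is F y >= -1. F increases on (0, y], and the explicit bound F z >= -1 - N z stands for
   its limit -1 at 0. *)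
pose F x := - poisson_cdf gam.+1 (N * x) - poisson_cdf gam.+1 (N / x).
have homoF z : 0 < z -> z <= y -> F z <= F y.
  move=> z0 zy.
  pose q x := (gam`!%:R)^-1 * x ^+ gam * expR (- x) : R.
  have dcomp h x a : is_derive x 1 h a ->
      is_derive x 1 (fun t => poisson_cdf gam.+1 (h t)) (- q (h x) * a).
    move=> dh; have := is_derive_poisson_cdf gam (h x) => dp.
    exact: (@is_derive1_comp _ (poisson_cdf gam.+1) h).
  apply: (@derivative_ge0_le _ F
    (fun x => N * q (N * x) - (N / x ^+ 2) * q (N / x)) z y zy).
    move=> x /andP[zx _]; have x0 : x != 0 by rewrite lt0r_neq0 //; lra.
    rewrite /F; derive_eq.
      notypeclasses refine (is_derive1D (is_derive1N (dcomp (fun t => N * t) _ _ _))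
        (is_derive1N (dcomp (fun t => N / t) _ _ _))); first by derive_by_rules.
      by derive_by_rules; exact: x0.
    by rewrite /=; field.
  move=> x /andP[zx xy]; have x0 : 0 < x by lra.
  (* With u = ln x <= 0, this compares u - e^u with its value at -u. *)
  have lnx : x^-1 - x + 2 * ln x >= 0.
    pose G t := - (t^-1 - t + 2 * ln t) : R.
    suff : G x <= G 1 by rewrite /G invr1 ln1; lra.
    apply: (@derivative_ge0_le _ G (fun t => (1 - t^-1) ^+ 2) x 1 ltac:(lra)).
      move=> t /andP[xt _]; have t0 : 0 < t by lra.
      rewrite /G; derive_eq.
        by derive_by_rules; [exact: lt0r_neq0|exact: t0].
      by rewrite /=; field; rewrite lt0r_neq0.
    by move=> t _; exact: sqr_ge0.
  suff : (N / x) ^+ gam * expR (- (N / x)) <=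
      (N * x) ^+ gam * expR (- (N * x)) * x ^+ 2.
    move=> h; rewrite subr_ge0 /q mulrAC ler_pdivrMr ?exprn_gt0 //.
    rewrite -!mulrA (ler_pM2l N0) ler_pM2l ?invr_gt0 //.
    by rewrite mulrA.
  rewrite -(lnK (x := x)) ?posrE //; set u := ln x.
  have -> : N / expR u = N * expR (- u) by rewrite expRN.
  rewrite !exprMn -!expRM_natl.
  rewrite -!mulrA ler_pM2l ?exprn_gt0 // -!expRD ler_expR.
  have -> : expR u = x by rewrite lnK.
  have -> : expR (- u) = x^-1 by rewrite expRN lnK.
  have := mulr_ge0 (ltW N0) lnx; rewrite -/u /N -natr1.
  by lra.
have Fge z : 0 < z -> z <= y -> - 1 - N * z <= F y.
  move=> z0 zy; apply: le_trans (homoF z z0 zy); rewrite /F.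
  have -> : - 1 - N * z = - 1 - N * (N / (N / z)).
    by rewrite invf_div [N * (z / N)]mulrC divfK ?lt0r_neq0.
  apply: lerB; first by rewrite lerN2 poisson_cdf_le1 // mulr_ge0 // ltW.
  by apply: poisson_cdf_le_inv; rewrite divr_gt0.
suff : - 1 <= F y by rewrite /F; lra.
rewrite leNgt; apply/negP => Fy.
(* Chosen so that N z is at most half the gap -1 - F y, whereas [Fge] bounds this gap by N z. *)
pose z := Num.min y ((- 1 - F y) / (2 * N)).
have d0 : 0 < (- 1 - F y) / (2 * N).
  by rewrite divr_gt0 ?mulr_gt0 //; lra.
have z0 : 0 < z by rewrite /z lt_min y0.
have := Fge z z0 ltac:(by rewrite /z ge_min lexx).
have : z * (2 * N) <= - 1 - F y.
  by rewrite -ler_pdivlMr ?mulr_gt0 // /z ge_min lexx orbT.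
by lra.
Qed.

End poisson_tails.

(** * Comparison of binomial and Poisson distribution functions *)

Section binomial_versus_poisson.
Context {R : realType}.
Implicit Types (gam n m i : nat) (p : R).

Lemma binomial_cdf_full n p : binomial_cdf n.+1 n p = 1.
Proof.
rewrite -[RHS](expr1n _ n) -[X in X ^+ n](subrK p) exprDn.
by apply: eq_bigr => i _; rewrite -mulrA -[RHS]mulr_natl [p ^+ i * _]mulrC.
Qed.

(* Each binomial probability is a Poisson probability times
   [n ^_ i / K ^ i * (1 - p) ^ (n - i) * exp (K * p)]. *)
Lemma binomial_le_poisson n i p (K : nat) : (0 < K)%N -> 0 <= p ->
  (i <= n)%N ->
  (n ^_ i)%:R * (1 - p) ^+ (n - i) * expR (K%:R * p) <= K%:R ^+ i ->
  'C(n, i)%:R * p ^+ i * (1 - p) ^+ (n - i) <=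
    (i`!%:R)^-1 * (K%:R * p) ^+ i * expR (- (K%:R * p)).
Proof.
move=> K0 p0 ilen h.
have f0 : 0 < i`!%:R :> R by rewrite ltr0n fact_gt0.
rewrite expRN ler_pdivlMr ?expR_gt0 // [leRHS]mulrC ler_pdivlMr //.
rewrite exprMn; have pi0 : 0 <= p ^+ i by exact: exprn_ge0.
have := ler_wpM2r pi0 h; rewrite -bin_ffact natrM.
by apply: le_trans; rewrite le_eqVlt; apply/orP; left; apply/eqP; ring.
Qed.

Lemma ratio_prod_ffact (n m : nat) : (m <= n)%N ->
  \prod_(j < m) (1 - j.+1%:R / n.+1%:R) = (n ^_ m)%:R / n.+1%:R ^+ m :> R.
Proof.
have n0 : n.+1%:R != 0 :> R by rewrite pnatr_eq0.
elim: m => [|m IHm] mn; first by rewrite big_ord0 ffactn0 expr0 divr1.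
rewrite big_ord_recr /= IHm ?(ltnW mn) // ffactnSr natrM natrB ?(ltnW mn) //.
rewrite exprS -[in (1 - _)]natr1 -(natr1 n); field.
by rewrite natr1 n0 expf_neq0.
Qed.

(** Termwise: from i to i + 1 the ratio of binomial to Poisson weights changes by (n - i) / ((n + 1)
    (1 - p)), which is at least 1 while i + 1 <= (n + 1) p. So the ratio is largest at i = gam - 1,
    where [binomial_poisson_ratio_le1] applies. *)
Lemma binomial_cdf_le_poisson gam n p : 0 < p < 1 ->
  gam%:R <= n.+1%:R * p -> gam%:R <= (n.+1%:R * p - gam%:R) ^+ 2 ->
  binomial_cdf gam n p <= poisson_cdf gam (n.+1%:R * p).
Proof.
move=> /andP[p0 p1].
case: gam => [|m] hm1 hm2.
  by rewrite /binomial_cdf /poisson_cdf !big_ord0.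
set K := n.+1%:R : R in hm1 hm2 *.
have K0 : 0 < K by rewrite ltr0n.
have mn : (m < n.+1)%N.
  by rewrite -(ltr_nat R) -/K; rewrite -natr1 in hm1; nra.
have base : (n ^_ m)%:R * (1 - p) ^+ (n - m) * expR (K * p) <= K ^+ m.
  have := @binomial_poisson_ratio_le1 _ m n.+1 (K * p) mn.
  rewrite -/K ratio_prod_ffact // [K * p / K]mulrAC divff ?lt0r_neq0 // mul1r /=.
  rewrite mulr_ge0 ?(ltW K0) ?(ltW p0) //= gtr_pMr // p1 => /(_ isT hm2).
  rewrite [_ / _ * (1 - p) ^+ _]mulrAC [_ / _ * expR _]mulrAC.
  by rewrite ler_pdivrMr ?exprn_gt0 // mul1r mulrAC.
have step k : (k <= m)%N ->
    (n ^_ (m - k))%:R * (1 - p) ^+ (n - (m - k)) * expR (K * p) <= K ^+ (m - k).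
  elim: k => [|k IHk] km; first by rewrite subn0.
  have := IHk (ltnW km).
  set i := (m - k.+1)%N; have -> : (m - k)%N = i.+1 by rewrite /i; lia.
  have im : (i < m)%N by rewrite /i; lia.
  rewrite ffactnSr natrM natrB; last by lia.
  have -> : (n - i = (n - i.+1).+1)%N by lia.
  rewrite !exprS => h; rewrite -(ler_pM2l K0); apply: le_trans h.
  set a : R := (n ^_ i)%:R; set b := (1 - p) ^+ _; set e := expR _.
  have -> : K * (a * ((1 - p) * b) * e) = (a * b * e) * (K - K * p) by ring.
  have -> : a * (n%:R - i%:R) * b * e = (a * b * e) * (n%:R - i%:R) by ring.
  rewrite ler_wpM2l //.
    by rewrite !mulr_ge0 ?expR_ge0 ?ler0n // exprn_ge0 // subr_ge0 ltW.
  have im' : i%:R + 1 <= m.+1%:R :> R by rewrite natr1 ler_nat; lia.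
  by rewrite /K in hm1 *; rewrite -(natr1 n) in hm1 *; lra.
apply: ler_sum => i _; have im := ltn_ord i.
apply: binomial_le_poisson => //; [exact: ltW | lia |].
by have := step (m - i)%N (leq_subr _ _); rewrite subKn // -ltnS.
Qed.

(** Proved on the complementary tail: above the mean the ratio of weights no longer grows, so the
    bound at i = gam persists. Complements are compared using that the binomial weights sum to 1 and
    the Poisson ones to at most 1. *)
Lemma binomial_cdf_ge_poisson gam n p : 0 < p < 1 ->
  n%:R * p <= gam%:R -> gam%:R <= (n%:R * p - gam%:R) ^+ 2 ->
  poisson_cdf gam (n%:R * p) <= binomial_cdf gam n p.
Proof.
move=> /andP[p0 p1] hg1 hg2.
have lam0 : 0 <= n%:R * p by rewrite mulr_ge0 // ltW.
have [ngam|gamn] := ltnP n gam.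
  apply: le_trans (poisson_cdf_le1 _ lam0) _.
  rewrite -(binomial_cdf_full n p) /binomial_cdf.
  rewrite -(big_mkord xpredT (fun i => 'C(n, i)%:R * p ^+ i * (1 - p) ^+ (n - i))).
  rewrite -(big_mkord xpredT (fun i => 'C(n, i)%:R * p ^+ i * (1 - p) ^+ (n - i))).
  rewrite (big_cat_nat (n := n.+1) (p := gam)) //= lerDl.
  rewrite big_nat_cond sumr_ge0 // => i _.
  by rewrite !mulr_ge0 ?exprn_ge0 ?subr_ge0 ?(ltW p0) ?(ltW p1).
case: gam => [|m] in hg1 hg2 gamn *.
  by rewrite /binomial_cdf /poisson_cdf !big_ord0.
case: n => [//|n] in lam0 hg1 hg2 gamn *.
set K := n.+1%:R : R in lam0 hg1 hg2 *.
have K0 : 0 < K by rewrite ltr0n.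
have step k : (m.+1 + k <= n.+1)%N ->
    (n.+1 ^_ (m.+1 + k))%:R * (1 - p) ^+ (n.+1 - (m.+1 + k)) * expR (K * p) <=
      K ^+ (m.+1 + k).
  elim: k => [|k IHk] km.
    have := @binomial_poisson_ratio_le1 _ m n.+1 (K * p) gamn.
    rewrite -/K ratio_prod_ffact // [K * p / K]mulrAC divff ?lt0r_neq0 // mul1r /=.
    rewrite lam0 /= gtr_pMr // p1 => /(_ isT hg2).
    rewrite [_ / _ * (1 - p) ^+ _]mulrAC [_ / _ * expR _]mulrAC.
    rewrite ler_pdivrMr ?exprn_gt0 // mul1r addn0 ffactSS natrM subSS exprS -/K.
    by rewrite -!mulrA ler_pM2l.
  have := IHk ltac:(lia); rewrite addnS; set i := (m.+1 + k)%N.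
  rewrite ffactnSr natrM natrB; last by rewrite /i; lia.
  have -> : (n.+1 - i = (n.+1 - i.+1).+1)%N by rewrite /i; lia.
  rewrite !exprS => h; apply: le_trans (ler_wpM2l (ltW K0) h).
  set a : R := (n.+1 ^_ i)%:R; set b := (1 - p) ^+ _; set e := expR _.
  have -> : K * (a * ((1 - p) * b) * e) = (a * b * e) * (K - K * p) by ring.
  have -> : a * (n.+1%:R - i%:R) * b * e = (a * b * e) * (K - i%:R) by rewrite /K; ring.
  rewrite ler_wpM2l //.
    by rewrite !mulr_ge0 ?expR_ge0 ?ler0n // exprn_ge0 // subr_ge0 ltW.
  have im' : m.+1%:R <= i%:R :> R by rewrite ler_nat /i; lia.
  by lra.
have pmf_le i : (m < i <= n.+1)%N ->
    'C(n.+1, i)%:R * p ^+ i * (1 - p) ^+ (n.+1 - i) <=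
    (i`!%:R)^-1 * (K * p) ^+ i * expR (- (K * p)).
  move=> /andP[mi ilen]; apply: binomial_le_poisson => //; first exact: ltW.
  by have := step (i - m.+1)%N; rewrite subnKC //; apply.
have := poisson_cdf_le1 n.+2 lam0; rewrite -(binomial_cdf_full n.+1 p).
rewrite /binomial_cdf /poisson_cdf.
rewrite -!(big_mkord xpredT (fun i => 'C(n.+1, i)%:R * p ^+ i * (1 - p) ^+ (n.+1 - i))).
rewrite -!(big_mkord xpredT (fun i => (i`!%:R)^-1 * (K * p) ^+ i * expR (- (K * p)))).
have split_sum (F : nat -> R) : \sum_(0 <= i < n.+2) F i =
    \sum_(0 <= i < m.+1) F i + \sum_(m.+1 <= i < n.+2) F i.
  by rewrite (big_cat_nat (n := m.+1)) //= ltnW.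
rewrite !split_sum.
have : \sum_(m.+1 <= i < n.+2) 'C(n.+1, i)%:R * p ^+ i * (1 - p) ^+ (n.+1 - i) <=
  \sum_(m.+1 <= i < n.+2) (i`!%:R)^-1 * (K * p) ^+ i * expR (- (K * p)).
  rewrite big_nat_cond [leRHS]big_nat_cond.
  by apply: ler_sum => i; rewrite andbT => /pmf_le.
by lra.
Qed.

End binomial_versus_poisson.

(** * Massart's form of Chernoff's bound *)

Section bernoulli_large_deviations.
Context {R : realType}.
Implicit Types (z p q t : R).

Definition massart_exponent z q : R :=
  let m := 2 * q / 3 + z / 3 in (q - z) ^+ 2 / (2 * m * (m - 1)).

Definition kl z p : R :=
  z * (ln z - ln p) + (1 - z) * (ln (1 - z) - ln (1 - p)).

(** In terms of m the exponent is a negative multiple of (z - m) / m times (z - m) / (1 - m). On (0,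
    z) the first factor decreases and the second does not increase, because z <= 1. *)
Lemma massart_exponent_increasing z q q' : 0 < q -> q < q' -> q' < z -> z <= 1 ->
  massart_exponent z q < massart_exponent z q'.
Proof.
move=> q0 qq' qz z1; rewrite /massart_exponent.
set m := 2 * q / 3 + z / 3; set m' := 2 * q' / 3 + z / 3.
have qE : q - z = - (3 / 2) * (z - m) by rewrite /m; field.
have q'E : q' - z = - (3 / 2) * (z - m') by rewrite /m'; field.
have [mm' m0 m'z] : [/\ m < m', 0 < m & m' < z] by rewrite /m /m'; split; lra.
rewrite {}qE {}q'E; clearbody m m'.
have d0 : 0 < 2 * m * (1 - m) by rewrite !mulr_gt0 //; lra.
have d'0 : 0 < 2 * m' * (1 - m') by rewrite !mulr_gt0 //; lra.
have E x : 0 < 2 * x * (1 - x) -> (- (3 / 2) * (z - x)) ^+ 2 / (2 * x * (x - 1)) =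
    - (9 / 4 * (z - x) ^+ 2 / (2 * x * (1 - x))).
  by move=> x0; field; nra.
rewrite !E // ltrN2 ltr_pdivrMr // [ltRHS]mulrAC ltr_pdivlMr //.
have h1 : (z - m') * m < (z - m) * m' by nra.
have h2 : (z - m') * (1 - m) <= (z - m) * (1 - m') by nra.
have h3 : 0 < (z - m) * (1 - m') by rewrite mulr_gt0; lra.
have h4 : 0 < (z - m') * m by rewrite mulr_gt0; lra.
have := ler_wpM2l (ltW h4) h2; have := h1; rewrite -(ltr_pM2r h3).
set a := z - m'; set b := z - m; nra.
Qed.

(** The case z = 1 of [kl_ge], set apart because the general argument divides by 1 - t up to t =
    z. *)
Lemma kl1_ge p : 0 < p < 1 -> 9 * (1 - p) / (4 * (2 * p + 1)) <= - ln p.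
Proof.
move=> /andP[p0 p1].
pose F t := ln t + 9 * (1 - t) / (4 * (2 * t + 1)).
suff : F p <= F 1 by rewrite /F ln1 subrr mulr0 mul0r addr0; lra.
apply: (@derivative_ge0_le _ F (fun t => (16 * t ^+ 2 - 11 * t + 4) /
  (4 * t * (2 * t + 1) ^+ 2)) p 1 (ltW p1)).
  move=> t /andP[pt _]; have t0 : 0 < t by lra.
  have t20 : 4 * (2 * t + 1) != 0 by rewrite lt0r_neq0 //; lra.
  rewrite /F; derive_eq; first by derive_by_rules; [exact: t0 | exact: t20].
  by rewrite /=; field; lra.
move=> t /andP[pt _]; rewrite divr_ge0 //; first by nra.
by rewrite !mulr_ge0 ?sqr_ge0 //; lra.
Qed.

(* [kl z] has derivative [(t - z) (1 / t + 1 / (1 - t))], and the convex second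
   factor lies above its tangent at [m]; integrated against [z - t] over [p, z],
   the slope of that tangent contributes zero. *)
Lemma kl_ge z p : 0 < p -> p < z -> z <= 1 -> - massart_exponent z p <= kl z p.
Proof.
move=> p0 pz; rewrite le_eqVlt => /predU1P[zE|z1].
  rewrite zE in pz *.
  rewrite /kl ln1 subrr mul0r addr0 mul1r sub0r.
  apply: le_trans (kl1_ge _); last by rewrite p0.
  rewrite /massart_exponent le_eqVlt; apply/orP; left; apply/eqP.
  by field; lra.
rewrite /massart_exponent; set m := 2 * p / 3 + z / 3.
have [m0 m1] : 0 < m /\ m < 1 by rewrite /m; split; lra.
pose c0 := m^-1 + (1 - m)^-1; pose c1 := (1 - m) ^- 2 - m ^- 2.
pose F t := - (z * (ln z - ln t) + (1 - z) * (ln (1 - z) - ln (1 - t))) +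
  (c0 + c1 * (z - m)) * (z - t) ^+ 2 / 2 - c1 * (z - t) ^+ 3 / 3.
have : F p <= F z.
  apply: (@derivative_ge0_le _ F (fun t =>
    (z - t) * ((t^-1 + (1 - t)^-1) - (c0 + c1 * (t - m)))) p z (ltW pz)).
    move=> t /andP[pt tz]; have t0 : 0 < t by lra.
    have t1 : 0 < 1 - t by lra.
    rewrite /F; derive_eq; first by derive_by_rules; [exact: t0 | exact: t1].
    by rewrite /=; clearbody c0 c1; field; rewrite (lt0r_neq0 t0) (lt0r_neq0 t1).
  move=> t /andP[pt tz]; rewrite mulr_ge0 //; first lra.
  have t0 : 0 < t by lra.
  have t1 : 0 < 1 - t by lra.
  have -> : t^-1 + (1 - t)^-1 - (c0 + c1 * (t - m)) =
    (t - m) ^+ 2 / (t * m ^+ 2) + (t - m) ^+ 2 / ((1 - t) * (1 - m) ^+ 2).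
    by rewrite /c0 /c1; field; rewrite ?(lt0r_neq0 t0) ?(lt0r_neq0 t1); lra.
  by rewrite addr_ge0 // divr_ge0 ?sqr_ge0 // mulr_ge0 ?sqr_ge0 // ltW.
rewrite /F /kl !subrr !mulr0 !expr0n /= !(mulr0, mul0r, addr0, subr0, oppr0).
have -> : (p - z) ^+ 2 / (2 * m * (m - 1)) = - (c0 * (z - p) ^+ 2 / 2).
  by rewrite /c0; field; lra.
have -> : z - m = 2 / 3 * (z - p) by rewrite /m; field.
by rewrite exprSr; nra.
Qed.

(** r is the optimal exponential tilt, under which a success has probability z. Then 1 - p + p r =
    (1 - p) / (1 - z) exceeds 1, so N may be replaced by the larger k / z, which leaves k / z times
    - kl z p in the exponent. *)
Lemma chernoff_factor z p (N k : nat) (r := z * (1 - p) / (p * (1 - z))) :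
  0 < p -> p < z -> z < 1 -> z * N%:R <= k%:R ->
  (1 - p + p * r) ^+ N <= r ^+ k * expR (k%:R / z * massart_exponent z p).
Proof.
move=> p0 pz z1 Nk.
have rE : 1 - p + p * r = (1 - p) / (1 - z) by rewrite /r; field; lra.
have r0 : 0 < r by rewrite divr_gt0 ?mulr_gt0 //; lra.
have B0 : 0 < (1 - p) / (1 - z) by rewrite divr_gt0 //; lra.
rewrite rE -[X in X ^+ N]lnK ?posrE // -[X in X ^+ k]lnK ?posrE //.
rewrite -!expRM_natl -expRD ler_expR.
have z0 : 0 < z by lra.
apply: le_trans (_ : _ <= k%:R / z * ln ((1 - p) / (1 - z))) _.
  apply: ler_wpM2r; last by rewrite ler_pdivlMr // mulrC.
  by apply: ln_ge0; rewrite ler_pdivlMr; lra.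
have -> : k%:R * ln r = k%:R / z * (z * ln r) by field; lra.
rewrite -mulrDr ler_wpM2l ?divr_ge0 ?(ltW z0) //.
have := kl_ge p0 pz (ltW z1); rewrite /kl /r !(ln_div, lnM) ?posrE ?mulr_gt0 //; lra.
Qed.

End bernoulli_large_deviations.

(** * Words of Bernoulli letters *)

Section bernoulli_words.
Context {R : realType}.
Implicit Types (n m k : nat) (p q c : R) (x y : seq bool) (E : pred (seq bool)).

Definition ones x := count_mem true x.

Definition word_weight p x : R := p ^+ ones x * (1 - p) ^+ (size x - ones x).

(** The sum of [word_weight] over the words of length n in E, organized by first letter so that
    induction on n needs no reindexing. *)
Fixpoint word_prob p n E : R :=
  if n is n'.+1 then
    p * word_prob p n' (fun x => E (true :: x)) +
    (1 - p) * word_prob p n' (fun x => E (false :: x))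
  else (E [::])%:R.

Lemma eq_word_prob p n E E' : (forall x, size x = n -> E x = E' x) ->
  word_prob p n E = word_prob p n E'.
Proof.
elim: n E E' => [|n IHn] E E' eqE /=; first by rewrite eqE.
by congr (_ * _ + _ * _); apply: IHn => x sx; apply: eqE; rewrite /= sx.
Qed.

Lemma word_prob_const p n (b : bool) : word_prob p n (fun=> b) = b%:R.
Proof. by elim: n => //= n ->; ring. Qed.

Lemma word_probC p n E : word_prob p n (fun x => ~~ E x) = 1 - word_prob p n E.
Proof.
elim: n E => [|n IHn] E /=; first by case: (E _); rewrite ?subr0 ?subrr.
by rewrite !IHn; ring.
Qed.

Lemma word_probU p n E E' : (forall x, E x -> E' x -> false) ->
  word_prob p n (fun x => E x || E' x) = word_prob p n E + word_prob p n E'.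
Proof.
elim: n E E' => [|n IHn] E E' dE /=.
  case: (boolP (E [::])) => E0 /=; last by rewrite add0r.
  by case: (boolP (E' [::])) => [/(dE _ E0)//|_]; rewrite addr0.
by rewrite !IHn; [ring | move=> x; exact: dE..].
Qed.

Lemma word_prob_ones p n k : word_prob p n (fun x => ones x == k) =
  'C(n, k)%:R * p ^+ k * (1 - p) ^+ (n - k).
Proof.
elim: n k => [|n IHn] [|k] /=.
- by rewrite bin0 !mul1r.
- by rewrite bin0n /= !mul0r.
- have -> : word_prob p n (fun x => ones (true :: x) == 0%N) = 0.
    by rewrite (@eq_word_prob p n _ (fun=> false)) ?word_prob_const.
  rewrite (@eq_word_prob p n _ (fun x => ones x == 0%N)) // IHn.
  by rewrite !bin0 !subn0 exprS; ring.
- have -> : word_prob p n (fun x => ones (true :: x) == k.+1) =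
    word_prob p n (fun x => ones x == k) by apply: eq_word_prob.
  rewrite [X in _ + _ * X](@eq_word_prob p n _ (fun x => ones x == k.+1)) // !IHn.
  have [kn|nk] := ltnP k n.
    rewrite binS natrD subSS (_ : n - k = (n - k.+1).+1)%N; last by lia.
    by rewrite !exprS; ring.
  rewrite binS (@bin_small n k.+1 nk) !mul0r mulr0 addr0 add0n subSS.
  by rewrite exprS; ring.
Qed.

Lemma word_prob_ones_lt p n k :
  word_prob p n (fun x => (ones x < k)%N) = binomial_cdf k n p.
Proof.
elim: k => [|k IHk].
  rewrite /binomial_cdf big_ord0.
  by rewrite (@eq_word_prob p n _ (fun=> false)) ?word_prob_const.
rewrite /binomial_cdf big_ord_recr /= -/(binomial_cdf k n p) -IHk -word_prob_ones.
rewrite -word_probU => [|x xk /eqP xk']; last by rewrite xk' ltnn in xk.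
by apply: eq_word_prob => x _; rewrite ltnS leq_eqVlt orbC.
Qed.

(** Markov's inequality for [r ^+ ones x], whose mean is the right-hand side. *)
Lemma word_prob_chernoff p n k r : 0 <= p <= 1 -> 1 <= r ->
  word_prob p n (fun x => (k <= ones x)%N) * r ^+ k <= (1 - p + p * r) ^+ n.
Proof.
move=> /andP[p0 p1] r1.
have b1 : 1 <= 1 - p + p * r by nra.
elim: n k => [|n IHn] [|k].
- by rewrite /= mulr1.
- by rewrite /= mul0r.
- rewrite (@eq_word_prob p n.+1 _ (fun=> true)) // word_prob_const mulr1.
  exact: exprn_ege1.
- have := IHn k.+1; have := IHn k; rewrite !exprS /=.
  set s := word_prob p n _; set t := word_prob p n _.
  set B := _ ^+ n; set rk := r ^+ k => h1 h2.
  have -> : (p * s + (1 - p) * t) * (r * rk) =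
    (p * r) * (s * rk) + (1 - p) * (t * (r * rk)) by ring.
  have pr0 : 0 <= p * r by nra.
  have := ler_wpM2l pr0 h1.
  have q0 : 0 <= 1 - p by lra.
  have := ler_wpM2l q0 h2.
  by set u := p * r; nra.
Qed.

(** Replaces Chernoff's bound at z = 1, where the optimal tilt is infinite. *)
Lemma word_prob_all_ones p n k : 0 <= p <= 1 -> (n <= k)%N ->
  word_prob p n (fun x => (k <= ones x)%N) <= p ^+ k.
Proof.
move=> /andP[p0 p1]; elim: n k => [|n IHn] [|k] //= nk.
- by rewrite exprn_ge0.
- have -> : word_prob p n (fun x => (k < ones (true :: x))%N) =
    word_prob p n (fun x => (k <= ones x)%N) by apply: eq_word_prob.
  have -> : word_prob p n (fun x => (k < ones (false :: x))%N) = 0.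
    rewrite (@eq_word_prob p n _ (fun=> false)) ?word_prob_const // => x sx.
    apply/negbTE; rewrite -leqNgt; have := count_size (pred1 true) x.
    by rewrite /ones /=; lia.
  by rewrite mulr0 addr0 exprS ler_wpM2l // IHn.
Qed.

Lemma word_prob_massart p z n k : 0 < p -> p < z -> z <= 1 -> z * n%:R <= k%:R ->
  word_prob p n (fun x => (k <= ones x)%N) <=
    expR (k%:R / z * massart_exponent z p).
Proof.
move=> p0 pz; rewrite le_eqVlt => /predU1P[z1|z1] nk.
  rewrite z1 in pz nk *; rewrite mul1r ler_nat in nk.
  apply: le_trans (word_prob_all_ones _ nk) _; first by rewrite !ltW.
  rewrite divr1 -[X in X ^+ k]lnK ?posrE // -expRM_natl ler_expR ler_wpM2l //.
  have := kl_ge p0 pz (lexx 1); rewrite /kl ln1 subrr mul0r addr0; lra.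
set r := z * (1 - p) / (p * (1 - z)).
have pz0 : 0 < p * (1 - z) by rewrite mulr_gt0 //; lra.
have r1 : 1 <= r by rewrite /r ler_pdivlMr //; nra.
have p01 : 0 <= p <= 1 by apply/andP; split; lra.
have := le_trans (word_prob_chernoff n k p01 r1) (chernoff_factor p0 pz z1 nk).
by rewrite -/r mulrC ler_pM2l // exprn_gt0 //; lra.
Qed.

Lemma word_weight_rcons p x (b : bool) :
  word_weight p (rcons x b) = word_weight p x * (if b then p else 1 - p).
Proof.
rewrite /word_weight /ones size_rcons -cats1 count_cat /=.
have := count_size (pred1 true) x; case: b => h /=.
  by rewrite addn0 addn1 subSS exprSr; ring.
by rewrite !addn0 subSn // exprSr; ring.
Qed.

(* Sum over the leaves of the tree of deciding prefixes. *)
Lemma word_prob_le_of_prefix p q n E : 0 <= q <= 1 ->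
  (forall x, size x = n -> E x -> exists m, [/\ (m <= n)%N,
     (forall y, size y = n -> take m y = take m x -> E y) &
     word_weight p (take m x) <= word_weight q (take m x)]) ->
  word_prob p n E <= word_prob q n E.
Proof.
move=> /andP[q0 q1] decE.
have w0 x : 0 <= word_weight q x.
  by rewrite mulr_ge0 // exprn_ge0 // subr_ge0.
(* Invariant of the descent: words of E that extend x have a deciding prefix no shorter than x. *)
pose undecided x := forall y, size y = n -> take (size x) y = x -> E y ->
  exists m, [/\ (size x <= m <= n)%N,
    (forall y', size y' = n -> take m y' = take m y -> E y') &
    word_weight p (take m y) <= word_weight q (take m y)].
suff H k x : (size x + k = n)%N -> undecided x ->
    word_weight p x * word_prob p k (fun y => E (x ++ y)) <=
    word_weight q x * word_prob q k (fun y => E (x ++ y)).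
  have := H n [::] erefl; rewrite /word_weight /= !mul1r; apply => y yn _ Ey.
  by have [m [mn Em wm]] := decE y yn Ey; exists m.
elim: k x => [|k IHk] x sx Ux.
  rewrite addn0 in sx; rewrite /= cats0; case Ex : (E x); last by rewrite !mulr0.
  have [|m [mn _]] := Ux x sx _ Ex; first by rewrite take_size.
  have -> : m = size x by lia.
  by rewrite take_size !mulr1.
(* Either x is a leaf, with conditional probability 1 under both parameters, or deciding prefixes
   are strictly longer and both children inherit the invariant. *)
have [[Ex wx]|leafF] := pselect
    ((forall y, size y = n -> take (size x) y = x -> E y) /\
     word_weight p x <= word_weight q x).
  have allE p' : word_prob p' k.+1 (fun y => E (x ++ y)) = 1.
    rewrite (@eq_word_prob p' _ _ (fun=> true)) ?word_prob_const // => y sy.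
    by rewrite Ex ?size_cat ?sy // take_size_cat.
  by rewrite !allE !mulr1.
have Hb b : word_weight p (rcons x b) * word_prob p k (fun y => E (x ++ b :: y)) <=
    word_weight q (rcons x b) * word_prob q k (fun y => E (x ++ b :: y)).
  have catE p' : word_prob p' k (fun y => E (x ++ b :: y)) =
      word_prob p' k (fun y => E (rcons x b ++ y)).
    by apply: eq_word_prob => y _; rewrite cat_rcons.
  rewrite !catE; apply: IHk; first by rewrite size_rcons addSnnS.
  move=> y sy yx Ey; rewrite size_rcons in yx *.
  have xy : take (size x) y = x.
    by rewrite -(take_takel y (leqnSn _)) yx -cats1 take_size_cat.
  have [m [/andP[xm mn] Em wm]] := Ux y sy xy Ey.
  exists m; split=> //; rewrite mn andbT ltn_neqAle xm andbT.
  apply/eqP => mx; apply: leafF; rewrite -mx xy in Em wm.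
  by split.
rewrite /= !mulrDr !mulrA; have := Hb true; have := Hb false.
by rewrite !word_weight_rcons => h1 h2; exact: lerD.
Qed.

End bernoulli_words.

(** * Monotonicity of stopping events in the parameter *)

Section monotone_events.
Context {R : realType}.
Implicit Types (n m k M N : nat) (p q c : R) (x y : seq bool).

(* The last hypothesis says that [q] lies between [p] and the maximum
   likelihood estimate [k / m]. *)
Lemma likelihood_le p q k m : 0 <= p <= 1 -> 0 < q < 1 -> (k <= m)%N ->
  (p - q) * (k%:R - m%:R * q) <= 0 ->
  p ^+ k * (1 - p) ^+ (m - k) <= q ^+ k * (1 - q) ^+ (m - k).
Proof.
move=> /andP[p0 p1] /andP[q0 q1] km h.
(* This is 1 + u <= e^u. Applied to both factors, it leaves the exponent (p - q) (k - m q) / (q (1 -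
   q)), whose sign is the hypothesis. *)
have le_exp (a b : R) : 0 < b -> a <= b * expR ((a - b) / b).
  move=> b0; apply: le_trans (_ : b * (1 + (a - b) / b) <= _).
    by rewrite mulrDr mulr1 mulrC divfK ?lt0r_neq0 // addrC subrK.
  by rewrite ler_pM2l // expR_ge1Dx.
have q10 : 0 < 1 - q by lra.
have hp := lerXn2r k p0 (mulr_ge0 (ltW q0) (expR_ge0 _)) (le_exp p q q0).
have p10 : 0 <= 1 - p by lra.
have hq := lerXn2r (m - k) p10 (mulr_ge0 (ltW q10) (expR_ge0 _))
  (le_exp (1 - p) (1 - q) q10).
apply: le_trans (ler_pM (exprn_ge0 _ p0) (exprn_ge0 _ p10) hp hq) _.
rewrite !exprMn -!expRM_natl mulrACA.
rewrite ler_piMr ?mulr_ge0 ?exprn_ge0 ?(ltW q0) ?(ltW q10) //.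
rewrite -expRD -[leRHS]expR0 ler_expR natrB //.
have -> : k%:R * ((p - q) / q) + (m%:R - k%:R) * ((1 - p - (1 - q)) / (1 - q)) =
    (p - q) * (k%:R - m%:R * q) / (q * (1 - q)) by field; lra.
by rewrite pmulr_lle0 // invr_gt0 mulr_gt0.
Qed.

Lemma ones_take_mono x m n : (m <= n)%N -> (ones (take m x) <= ones (take n x))%N.
Proof.
move=> mn; rewrite -(take_takel x mn) /ones.
by rewrite -[in leqRHS](cat_take_drop m (take n x)) count_cat leq_addr.
Qed.

Lemma ones_take_hit x k N : (k <= ones (take N x))%N ->
  exists m, [/\ (m <= N)%N, ones (take m x) = k &
    forall n, (ones (take n x) < k)%N -> (n < m)%N].
Proof.
elim: N k => [|N IHN] k kN.
  move: kN; rewrite take0 leqn0 => /eqP ->.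
  by exists 0%N; rewrite take0.
have [kN'|Nk] := leqP k (ones (take N x)).
  by have [m [mN mk mh]] := IHN k kN'; exists m; split=> //; exact: leqW.
exists N.+1; split=> //.
  apply/eqP; rewrite eqn_leq kN andbT; apply: leq_trans Nk.
  have [Nx|xN] := ltnP N (size x); last by rewrite !take_oversize ?leqW.
  rewrite (take_nth false) // /ones -cats1 count_cat /= addn0 -addn1 leq_add2l.
  by case: nth.
move=> n nk; rewrite ltnNge; apply/negP => Nn.
by have := ones_take_mono x Nn; rewrite leqNgt (leq_trans nk kN).
Qed.

Lemma word_weight_take p x m : (m <= size x)%N ->
  word_weight p (take m x) = p ^+ ones (take m x) * (1 - p) ^+ (m - ones (take m x)).
Proof. by move=> mx; rewrite /word_weight size_takel. Qed.

Lemma ones_take_le x m : (ones (take m x) <= m)%N.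
Proof.
apply: leq_trans (count_size _ _) _; rewrite size_take.
by case: ltnP.
Qed.

(** The form of an underestimate: k is not reached within M samples, the present stage stops, the
    previous one did not. The flag b marks a stage that stops on every path. Without it the event is
    decided at the hitting time m > M of k, with it at time max M N'; in both cases the observed
    frequency is at most c <= q. *)
Lemma word_prob_late_le p q c n k M (b : bool) N k' N'
    (E := fun x => [&& ones (take M x) < k, b || (k <= ones (take N x)) &
                       ones (take N' x) < k']%N) :
  0 < c -> c <= q -> q <= p -> p <= 1 -> q < 1 -> (k' <= k)%N ->
  (M <= n)%N -> (N <= n)%N -> (N' <= n)%N -> k%:R <= c * M.+1%:R ->
  word_prob p n E <= word_prob q n E.
Proof.
move=> c0 cq qp p1 q1 k'k Mn Nn N'n kM.
have q0 : 0 < q by lra.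
have p0 : 0 <= p by lra.
have wle m x : (m <= n)%N -> size x = n -> (ones (take m x))%:R <= c * m%:R ->
    word_weight p (take m x) <= word_weight q (take m x).
  move=> mn xn om; rewrite !word_weight_take ?xn //.
  apply: likelihood_le; rewrite ?p0 ?q0 ?ones_take_le //.
  have : c * m%:R <= m%:R * q by rewrite mulrC ler_wpM2l.
  by move=> ?; rewrite mulr_ge0_le0 //; lra.
apply: word_prob_le_of_prefix => [|x xn]; first by rewrite !ltW.
rewrite /E; case: b @E => E /and3P[xM xN xN'].
  exists (maxn M N'); split; first by rewrite geq_max Mn.
    move=> y yn yx; rewrite /E /= -(take_takel y (leq_maxl M N')) yx.
    rewrite -(take_takel y (leq_maxr M N')) yx.
    by rewrite !take_takel ?leq_maxl ?leq_maxr // xM.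
  apply: wle => //; first by rewrite geq_max Mn.
  (* The count is at most k - 1 here, and c <= 1 pays for passing from M + 1 to M. *)
  have kM1 : k%:R - 1 <= c * M%:R by rewrite -natr1 in kM; nra.
  apply: le_trans (_ : k%:R - 1 <= _).
    rewrite lerBrDr natr1 ler_nat /maxn; case: ifP => // _.
    exact: leq_trans xN' k'k.
  by apply: le_trans kM1 _; rewrite ler_pM2l // ler_nat leq_maxl.
have [m [mN mk mh]] := ones_take_hit xN.
have Mm : (M < m)%N by exact: mh.
have N'm : (N' <= m)%N by apply/ltnW/mh; exact: leq_trans xN' k'k.
exists m; split; first exact: leq_trans Nn.
  move=> y yn yx; apply/and3P; split.
  - by rewrite -(take_takel y (ltnW Mm)) yx take_takel // ltnW.
  - by rewrite /= -mk -yx; exact: ones_take_mono.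
  - by rewrite -(take_takel y N'm) yx take_takel.
apply: wle => //; first exact: leq_trans Nn.
by rewrite mk; apply: le_trans kM _; rewrite ler_pM2l // ler_nat.
Qed.

(** The form of an overestimate. It is decided at the hitting time m <= C of k, where k / m >= c >=
    q; as k' <= k, the condition at N' is settled by then. *)
Lemma word_prob_early_le p q c n k C k' N'
    (E := fun x => ((k <= ones (take C x)) && (ones (take N' x) < k'))%N) :
  0 <= p -> p <= q -> 0 < q < 1 -> q <= c -> (k' <= k)%N ->
  (C <= n)%N -> (N' <= n)%N -> c * C%:R <= k%:R ->
  word_prob p n E <= word_prob q n E.
Proof.
move=> p0 pq /andP[q0 q1] qc k'k Cn N'n kC.
apply: word_prob_le_of_prefix => [|x xn]; first by rewrite !ltW.
move=> /andP[xC xN'].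
have [m [mC mk mh]] := ones_take_hit xC.
have N'm : (N' <= m)%N by apply/ltnW/mh; exact: leq_trans xN' k'k.
have mn : (m <= n)%N by exact: leq_trans Cn.
exists m; split=> //.
  move=> y yn yx; apply/andP; split.
  - by rewrite /= -mk -yx; exact: ones_take_mono.
  - by rewrite -(take_takel y N'm) yx take_takel.
rewrite !word_weight_take ?xn //.
apply: likelihood_le; rewrite ?p0 ?q0 ?ones_take_le //; first by lra.
have : m%:R * q <= k%:R.
  apply: le_trans kC; rewrite mulrC; apply: ler_pM => //; first exact: ltW.
  by rewrite ler_nat.
by rewrite mk => ?; rewrite mulr_le0_ge0 //; lra.
Qed.

End monotone_events.

(** * Inverse binomial sampling *)

Section words_of_samples.
Context {R : realType} {d : measure_display} {T : measurableType d}.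
Variable X : nat -> {mfun T >-> bool}.
Implicit Types (n m k : nat) (w : T) (x : seq bool) (E : pred (seq bool)).

Definition word n w : seq bool := mkseq (fun i => X i w) n.

Lemma size_word n w : size (word n w) = n.
Proof. by rewrite size_mkseq. Qed.

Lemma take_word m n w : (m <= n)%N -> take m (word n w) = word m w.
Proof. by move=> mn; rewrite /word /mkseq -map_take take_iota (minn_idPl mn). Qed.

Lemma wordS n w : word n.+1 w = rcons (word n w) (X n w).
Proof. by rewrite /word mkseqS. Qed.

Lemma ones_word n w : ones (word n w) = successes X n w.
Proof.
elim: n => [|n IHn]; first by rewrite /successes big_ord0.
rewrite wordS /ones -cats1 count_cat -/(ones _) IHn /successes big_ord_recr /=.
by case: (X n w); rewrite !addn0.
Qed.

Lemma successes_mono m n w : (m <= n)%N -> (successes X m w <= successes X n w)%N.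
Proof.
move=> mn; rewrite -!ones_word -(take_word _ mn) -[in leqRHS](take_word w (leqnn n)).
exact: ones_take_mono.
Qed.

Let eq_word x := [set w | word (size x) w = x].

Lemma eq_word_bigcap x : eq_word x =
  \bigcap_(i in [set` iota 0 (size x)]) (X i @^-1` [set nth false x i]).
Proof.
apply/seteqP; split => [w <- i /=|w xw].
  rewrite mem_iota add0n size_word => /andP[_ ilt].
  by rewrite nth_mkseq.
apply: (@eq_from_nth _ false); first by rewrite size_word.
move=> i; rewrite size_word => ilt; rewrite nth_mkseq //.
by apply: (xw i); rewrite /= mem_iota.
Qed.

Lemma measurable_eq_word x : measurable (eq_word x).
Proof.
rewrite eq_word_bigcap; apply: fin_bigcap_measurable; first exact: finite_seq.
by move=> i _; rewrite -[X in measurable X]setTI; exact: measurable_funP.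
Qed.

Variables (P : probability T R) (p : R).
Hypothesis iid_X : iid_bernoulli P X p.

Lemma prob_eq_word x : P (eq_word x) = (word_weight p x)%:E.
Proof.
have [indX margX] := iid_X.
rewrite eq_word_bigcap (indX _ (fun i => [set nth false x i])) ?iota_uniq //.
under eq_bigr => i _.
  rewrite (_ : P _ = (if nth false x i then p else 1 - p)%:E); last first.
    by case: (nth false x i); have [? ?] := margX i.
  over.
rewrite prodEFin; congr EFin.
have -> : iota 0 (size x) = index_iota 0 (size x) by rewrite /index_iota subn0.
rewrite -(big_nth false xpredT (fun b => if b then p else 1 - p)).
elim/last_ind: x => [|x b IHx]; first by rewrite big_nil /word_weight /= mulr1.
by rewrite -cats1 big_cat big_seq1 /= IHx cats1 word_weight_rcons.
Qed.

Let words_from x n E := [set w | word (size x) w = x /\ E (word (size x + n) w)].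

(** Carrying a prefix x lets the induction split on the letter that follows it, as [word_prob] does.
    Independence enters through the base case [prob_eq_word]. *)
Lemma words_fromP x n E : measurable (words_from x n E) /\
  P (words_from x n E) = (word_weight p x * word_prob p n (fun y => E (x ++ y)))%:E.
Proof.
elim: n x => [|n IHn] x.
  rewrite /words_from addn0 /= cats0; case Ex : (E x).
    rewrite (_ : [set w | _] = eq_word x); last first.
      by apply/seteqP; split=> w /= => [[]//|wx]; rewrite wx.
    by split; [exact: measurable_eq_word | rewrite prob_eq_word mulr1].
  rewrite (_ : [set w | _] = set0); last first.
    by apply/seteqP; split=> w //= [-> ]; rewrite Ex.
  by rewrite measure0 mulr0; split.
have split_letter : words_from x n.+1 E =
    words_from (rcons x true) n E `|` words_from (rcons x false) n E.
  rewrite /words_from !size_rcons !addSnnS; apply/seteqP; split => [w [wx Ew]|w].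
    by case Xb : (X (size x) w); [left|right]; rewrite /= wordS wx Xb.
  by case=> -[+ Ew]; rewrite wordS => /rcons_inj[wx _].
have [mt Pt] := IHn (rcons x true); have [mf Pf] := IHn (rcons x false).
split; rewrite split_letter; first exact: measurableU.
transitivity (P (words_from (rcons x true) n E) + P (words_from (rcons x false) n E))%E.
  apply: measureU => //; apply/seteqP; split=> w //= [[+ _] [+ _]].
  by rewrite !size_rcons => -> /rcons_inj[].
rewrite Pt Pf -EFinD; congr EFin; rewrite !word_weight_rcons /=.
rewrite (@eq_word_prob _ p n (fun y => E (rcons x true ++ y))
    (fun y => E (x ++ true :: y))); last first.
  by move=> y _; rewrite cat_rcons.
rewrite (@eq_word_prob _ p n (fun y => E (rcons x false ++ y))
    (fun y => E (x ++ false :: y))); last first.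
  by move=> y _; rewrite cat_rcons.
by ring.
Qed.

Lemma measurable_word n E : measurable [set w | E (word n w)].
Proof.
have [+ _] := words_fromP [::] n E; congr measurable.
by apply/seteqP; split=> w /= => [[]|].
Qed.

Lemma prob_word n E : P [set w | E (word n w)] = (word_prob p n E)%:E.
Proof.
have [_] := words_fromP [::] n E; rewrite /word_weight /= !mul1r => <-.
by congr (P _); apply/seteqP; split=> w /= => [|[]].
Qed.

End words_of_samples.

(** * Sample means at hitting times as events on fixed numbers of samples *)

Section inverse_sampling.
Context {R : realType} {d : measure_display} {T : measurableType d}.
Variable X : nat -> {mfun T >-> bool}.
Implicit Types (k n : nat) (w : T) (c : R).

Lemma successes0 w : successes X 0 w = 0%N.
Proof. by rewrite /successes big_ord0. Qed.

Lemma sample_meanP k w (ph : R := sample_mean X (sample_size X k w) w) : (0 < k)%N ->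
  (ph = 0 /\ forall n, (successes X n w < k)%N) \/
  exists m, [/\ (0 < m)%N, ph = k%:R / m%:R &
    forall n, (m <= n)%N = (k <= successes X n w)%N].
Proof.
move=> k0.
have hit n : (k <= successes X n w)%N -> exists2 j, (j <= n)%N & successes X j w == k.
  rewrite -ones_word -(take_word _ w (leqnn n)) take_word // => kn.
  have {}kn : (k <= ones (take n (word X n w)))%N by rewrite take_word.
  have [j [jn jk _]] := ones_take_hit kn.
  by exists j => //; rewrite -ones_word -(take_word X w jn) jk.
rewrite /ph /sample_size; case: pselect => [h|noh].
  right; case: ex_minnP => m /eqP mk mmin; exists m; split.
  - by rewrite lt0n; apply/eqP => m0; rewrite m0 successes0 in mk; rewrite -mk in k0.
  - by rewrite /sample_mean mk.
  - move=> n; apply/idP/idP => [mn|/hit[j jn jk]]; first by rewrite -mk successes_mono.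
    exact: leq_trans (mmin _ jk) jn.
left; split; first by rewrite /sample_mean successes0 mul0r.
by move=> n; rewrite ltnNge; apply/negP => /hit[j _ jk]; apply: noh; exists j.
Qed.

Lemma sample_mean_ge0 k w : 0 <= sample_mean X (sample_size X k w) w :> R.
Proof. by rewrite /sample_mean divr_ge0. Qed.

(** k / m >= c says that the hitting time m is at most C. If k is never reached, the default mean 0
    is below c, so the equivalence holds on every path. *)
Lemma le_sample_mean c k C w : 0 < c -> (0 < k)%N ->
  (forall n, (c * n%:R <= k%:R) = (n <= C)%N) ->
  (c <= sample_mean X (sample_size X k w) w) = (k <= successes X C w)%N.
Proof.
move=> c0 k0 hC.
have [[-> Sk]|[m [m0 -> hm]]] := sample_meanP w k0.
  by rewrite leNgt c0 leqNgt Sk.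
by rewrite ler_pdivlMr ?ltr0n // hC hm.
Qed.

Lemma lt_sample_mean c k M w : 0 < c -> (0 < k)%N ->
  (forall n, (c * n%:R < k%:R) = (n <= M)%N) ->
  (c < sample_mean X (sample_size X k w) w) = (k <= successes X M w)%N.
Proof.
move=> c0 k0 hM.
have [[-> Sk]|[m [m0 -> hm]]] := sample_meanP w k0.
  by rewrite ltNge ltW //= leqNgt Sk.
by rewrite ltr_pdivlMr ?ltr0n // hM hm.
Qed.

Lemma last_le c k : 0 < c -> exists C, forall n, (c * n%:R <= k%:R) = (n <= C)%N.
Proof.
move=> c0; exists (Num.truncn (k%:R / c)) => n.
by rewrite truncn_ge_nat ?divr_ge0 ?(ltW c0) // ler_pdivlMr // mulrC.
Qed.

Lemma last_lt c k : 0 < c -> (0 < k)%N ->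
  exists M, forall n, (c * n%:R < k%:R) = (n <= M)%N.
Proof.
move=> c0 k0.
have exN : exists n, k%:R <= c * n%:R.
  have [C hC] := last_le k c0; exists C.+1.
  by rewrite ltW // ltNge hC ltnn.
case: (ex_minnP exN) => -[|M] hM Mmin.
  by rewrite mulr0 lern0 in hM; move: hM k0 => /eqP->.
exists M => n; apply/idP/idP => [h|nM].
  rewrite -ltnS ltnNge; apply/negP => Mn.
  move: h; rewrite ltNge => /negP; apply; apply: le_trans hM _.
  by rewrite ler_pM2l // ler_nat.
by rewrite ltNge; apply/negP => /Mmin; rewrite ltnNge nM.
Qed.

End inverse_sampling.

(** * Thresholds and stages *)

Section parameters.
Context {R : realType}.
Variables eps delta zeta rho : R.
Hypotheses (eps01 : 0 < eps < 1) (delta01 : 0 < delta < 1).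
Hypotheses (zeta0 : 0 < zeta) (rho0 : 0 < rho).
Hypothesis zeta_ln : ln (zeta * delta) <
  ((1 + eps + Num.sqrt (1 + 4 * eps + eps ^+ 2)) ^+ 2 / (4 * eps ^+ 2)
    + 1 / 2) * (eps / (1 + eps) - ln (1 + eps)).

Let s := stages eps delta zeta rho.
Let gam := gamma_ eps delta zeta rho.
Let z := z_ eps delta zeta rho.
Let L := - ln (zeta * delta).
Let base := 4 * (3 + eps) / (9 * eps) * L.

(** The square root is at least 1 + eps, and the term 1/2 is dropped. *)
Lemma bracket_ge : ((1 + eps) / eps) ^+ 2 <=
  (1 + eps + Num.sqrt (1 + 4 * eps + eps ^+ 2)) ^+ 2 / (4 * eps ^+ 2) + 1 / 2.
Proof.
have [e0 e1] := andP eps01.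
set r := Num.sqrt _.
have r1 : 1 + eps <= r.
  rewrite -[leLHS]ger0_norm; last lra.
  by rewrite -sqrtr_sqr ler_sqrt; nra.
rewrite expr_div_n ler_wpDr // ?divr_ge0 //.
rewrite ler_pdivlMr ?mulr_gt0 ?exprn_gt0 // mulrAC ler_pdivrMr ?exprn_gt0 //.
rewrite mulrA ler_pM2r ?exprn_gt0 //.
by nra.
Qed.

Lemma L_ge : 3 * (1 + eps) / (2 * (3 + eps)) <= L.
Proof.
have [e0 e1] := andP eps01.
have k_ge := ln1D_ge (ltW e0).
have := bracket_ge; set B := _ + 1 / 2 => B_ge.
have : - ln (zeta * delta) >= B * (ln (1 + eps) - eps / (1 + eps)).
  by rewrite -lerN2 opprK -mulrN opprB ltW.
apply: le_trans; apply: le_trans (ler_pM _ _ B_ge k_ge); last 2 first.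
- exact: sqr_ge0.
- by rewrite divr_ge0 ?mulr_ge0 ?exprn_ge0 //; lra.
by rewrite le_eqVlt; apply/orP; left; apply/eqP; field; lra.
Qed.

Lemma L_gt0 : 0 < L.
Proof.
have [e0 e1] := andP eps01.
by apply: lt_le_trans L_ge; rewrite divr_gt0 //; lra.
Qed.

Lemma base_gt0 : 0 < base.
Proof.
have [e0 e1] := andP eps01.
by rewrite mulr_gt0 ?L_gt0 // divr_gt0 //; lra.
Qed.

Lemma ratio_max_gt1 : 1 < ratio_max eps.
Proof.
have [e0 e1] := andP eps01.
have : 1 <= eps^-1 by rewrite invf_ge1 // ltW.
by rewrite /ratio_max; lra.
Qed.

Lemma threshold_ge i :
  ratio_max eps `^ (i%:R / (tau eps rho)%:R) * base <=
    (threshold eps delta zeta rho i)%:R.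
Proof.
have zd0 : 0 < zeta * delta by have [d0 _] := andP delta01; exact: mulr_gt0.
rewrite /threshold lnV ?posrE // -/L -mulrA -/base.
set v := _ * base.
have v0 : 0 <= v by rewrite mulr_ge0 ?powR_ge0 // ltW // base_gt0.
rewrite [leRHS]natr_absz ger0_norm ?ceil_ge //.
by rewrite ceil_ge0 (lt_le_trans _ v0) // ltrN10.
Qed.

Lemma gammas_ge (k : nat) : k \in gammas eps delta zeta rho -> base <= k%:R.
Proof.
rewrite /gammas mem_sort mem_undup => /mapP[i _ ->].
apply: le_trans (threshold_ge i); rewrite ler_peMl ?(ltW base_gt0) //.
rewrite -[leLHS](powRr0 (ratio_max eps)).
apply: ler_powR; first exact: ltW ratio_max_gt1.
by rewrite divr_ge0.
Qed.

Lemma threshold_in_gammas i : (i <= tau eps rho)%N ->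
  threshold eps delta zeta rho i \in gammas eps delta zeta rho.
Proof.
by move=> it; rewrite /gammas mem_sort mem_undup map_f // mem_iota add0n ltnS.
Qed.

Lemma stages_gt0 : (0 < s)%N.
Proof.
by have := threshold_in_gammas (leq0n _); rewrite /s /stages; case: gammas.
Qed.

Lemma gamma_lt l l' : (0 < l)%N -> (l < l')%N -> (l' <= s)%N -> (gam l < gam l')%N.
Proof.
move=> l0 ll' l's; apply: (sorted_ltn_nth ltn_trans).
- rewrite ltn_sorted_uniq_leq /gammas sort_uniq undup_uniq.
  exact: sort_sorted leq_total _.
- by rewrite inE; rewrite /s /stages in l's; lia.
- by rewrite inE; rewrite /s /stages in l's; lia.
- by lia.
Qed.

Lemma gamma_le l l' : (0 < l)%N -> (l <= l')%N -> (l' <= s)%N -> (gam l <= gam l')%N.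
Proof.
move=> l0; rewrite leq_eqVlt => /predU1P[->//|ll' l's].
exact/ltnW/gamma_lt.
Qed.

Lemma gamma_in l : (0 < l <= s)%N -> gam l \in gammas eps delta zeta rho.
Proof. by case: l => [//|l] /andP[_ ls]; exact: mem_nth. Qed.

Lemma gamma_ge l : (0 < l <= s)%N -> base <= (gam l)%:R.
Proof. by move=> ls; exact/gammas_ge/gamma_in. Qed.

Lemma gamma_gt0 l : (0 < l <= s)%N -> (0 < gam l)%N.
Proof. by move=> /gamma_ge h; rewrite -(ltr0n R); exact: lt_le_trans base_gt0 h. Qed.

(** Ensures that the exponent i / tau is 1 at i = tau; division by 0 would make it 0. *)
Lemma tau_gt0 : (0 < tau eps rho)%N.
Proof.
have r0 : 0 < ln (1 + rho) by rewrite ln_gt0 // ltrDl.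
by rewrite absz_gt0 ceil_neq0 divr_gt0 ?orbT // ln_gt0 // ratio_max_gt1.
Qed.

Lemma gamma_last_ge : ratio_max eps * base <= (gam s)%:R.
Proof.
have := threshold_ge (tau eps rho).
rewrite divff ?pnatr_eq0 -?lt0n ?tau_gt0 // powRr1; last first.
  exact: le_trans ler01 (ltW ratio_max_gt1).
move=> /le_trans; apply; rewrite ler_nat.
have /(nthP 0%N)[i ilt <-] := threshold_in_gammas (leqnn _).
have : (gam i.+1 <= gam s)%N by exact: gamma_le.
by [].
Qed.

Lemma gamma_last_large : ((1 + eps) / eps) ^+ 2 <= (gam s)%:R.
Proof.
have [e0 e1] := andP eps01.
apply: le_trans gamma_last_ge; rewrite /base /ratio_max mulrA.
have c0 : 0 <= 3 / 2 * (eps^-1 + 1) * (4 * (3 + eps) / (9 * eps)).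
  by rewrite !mulr_ge0 ?invr_ge0 ?addr_ge0 ?invr_ge0 //; lra.
apply: le_trans (ler_wpM2l c0 L_ge).
by rewrite le_eqVlt; apply/orP; left; apply/eqP; field; lra.
Qed.

(** z_l is affine in gamma_l with slope [- slope]. It equals 1 and 0 exactly at the thresholds i = 0
    and i = tau before rounding up, which yields z_l <= 1 and z_s <= 0. *)
Let slope := 9 * eps ^+ 2 / (2 * (3 + eps) ^+ 2 * L).

Lemma slope_gt0 : 0 < slope.
Proof.
have [e0 e1] := andP eps01; have L0 := L_gt0.
by rewrite divr_gt0 ?mulr_gt0 ?exprn_gt0 //; lra.
Qed.

Lemma zE l : z l = 1 + 2 * eps / (3 + eps) - slope * (gam l)%:R.
Proof.
have [e0 e1] := andP eps01; have L0 := L_gt0.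
rewrite /z /z_ -/gam (_ : ln (zeta * delta) = - L) /slope; last by rewrite /L opprK.
by move: L L0 => a a0; field; lra.
Qed.

Lemma z_le1 l : (0 < l <= s)%N -> z l <= 1.
Proof.
move=> /gamma_ge h; rewrite zE.
have [e0 e1] := andP eps01; have L0 := L_gt0.
have := ler_wpM2l (ltW slope_gt0) h.
have -> : slope * base = 2 * eps / (3 + eps).
  by rewrite /slope /base; move: L L0 => a a0; field; lra.
by lra.
Qed.

(** Hence D_s = 1 on every path, even where the estimate has its default value 0, and sampling
    always stops. *)
Lemma z_last_le0 : z s <= 0.
Proof.
rewrite zE.
have [e0 e1] := andP eps01; have L0 := L_gt0.
have := ler_wpM2l (ltW slope_gt0) gamma_last_ge.
have -> : slope * (ratio_max eps * base) = 1 + 2 * eps / (3 + eps).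
  by rewrite /slope /base /ratio_max; move: L L0 => a a0; field; lra.
by lra.
Qed.

Lemma z_antitone l l' : (0 < l)%N -> (l <= l')%N -> (l' <= s)%N -> z l' <= z l.
Proof.
move=> l0 ll' l's; rewrite !zE lerD2l lerN2 ler_pM2l ?slope_gt0 //.
by rewrite ler_nat gamma_le.
Qed.

Lemma stages_gt1 q : is_pstar eps delta zeta rho q -> (1 < s)%N.
Proof.
move=> [/andP[q0 qz] _]; rewrite ltnNge; apply/negP => s1.
(* For s = 1 the index s - 1 = 0 reads the first threshold again, since [0.-1] is 0; so z_(s-1) =
   z_s <= 0 leaves no room for p^*. *)
have sE : s = 1%N by have := stages_gt0; lia.
have := z_last_le0; rewrite leNgt => /negP; apply; apply: lt_trans q0 _.
by move: qz; rewrite -/s sE.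
Qed.

Lemma pstar_lhsE q : pstar_lhs eps delta zeta rho q =
  g eps (gam s) +
  \sum_(1 <= l < s) expR ((gam l)%:R / z l * massart_exponent (z l) q).
Proof. by []. Qed.

Lemma pstar_exponent_increasing l q q' : (0 < l < s)%N -> 0 < q -> q < q' ->
  q' < z s.-1 ->
  expR ((gam l)%:R / z l * massart_exponent (z l) q) <
  expR ((gam l)%:R / z l * massart_exponent (z l) q').
Proof.
move=> /andP[l0 ls] q0 qq' q'z.
have ls' : (0 < l <= s)%N by rewrite l0 ltnW.
have q'zl : q' < z l.
  apply: lt_le_trans q'z (z_antitone l0 _ (leq_pred s)).
  by rewrite -ltnS (ltn_predK ls).
have zl0 : 0 < z l by apply: lt_trans q'zl; exact: lt_trans qq'.
have gl0 := gamma_gt0 ls'.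
rewrite ltr_expR ltr_pM2l; last by rewrite divr_gt0 // ltr0n.
exact: massart_exponent_increasing (z_le1 ls').
Qed.

Lemma pstar_lhs_increasing q q' : (1 < s)%N -> 0 < q -> q < q' -> q' < z s.-1 ->
  pstar_lhs eps delta zeta rho q < pstar_lhs eps delta zeta rho q'.
Proof.
move=> s1 q0 qq' q'z; rewrite !pstar_lhsE ltrD2l.
rewrite big_ltn // [ltRHS]big_ltn //.
apply: ltr_leD; first by apply: pstar_exponent_increasing; rewrite ?s1.
rewrite big_nat_cond [leRHS]big_nat_cond; apply: ler_sum => l; rewrite andbT => ls.
by apply/ltW/pstar_exponent_increasing => //; lia.
Qed.

Lemma pstar_unique q q' : is_pstar eps delta zeta rho q ->
  is_pstar eps delta zeta rho q' -> q = q'.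
Proof.
move=> qP; have s1 := stages_gt1 qP; move: qP => [/andP[q0 qz] qE].
move=> [/andP[q'0 q'z] q'E].
have [qq'|q'q|//] := ltgtP q q'.
  by have := pstar_lhs_increasing s1 q0 qq' q'z; rewrite qE q'E ltxx.
by have := pstar_lhs_increasing s1 q'0 q'q qz; rewrite qE q'E ltxx.
Qed.

End parameters.

(** * Error probabilities of the sampling scheme *)

Section finite_unions.
Context {R : realType} {d : measure_display} {T : measurableType d}.
Implicit Types (P : probability T R) (A : nat -> set T) (r : seq nat).

Lemma mem_bigsetU A r l w : l \in r -> A l w -> (\big[setU/set0]_(i <- r) A i) w.
Proof.
elim: r => [//|j r IHr]; rewrite inE big_cons => /predU1P[->|lr] Aw; first by left.
by right; exact: IHr.
Qed.

Lemma prob_bigsetU_le P A r : (forall l, measurable (A l)) ->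
  (P (\big[setU/set0]_(l <- r) A l) <= \sum_(l <- r) P (A l))%E.
Proof.
move=> mA; elim: r => [|j r IHr]; first by rewrite !big_nil measure0.
rewrite !big_cons; apply: le_trans (measureU2 _ _ _) _ => //.
  exact: bigsetU_measurable.
exact: leeD2l.
Qed.

Lemma prob_ge_of_cover P (G B B' : set T) (a b : R) :
  measurable G -> measurable B -> measurable B' ->
  (P B <= a%:E)%E -> (P B' <= b%:E)%E -> ~` G `<=` B `|` B' ->
  ((1 - (a + b))%:E <= P G)%E.
Proof.
move=> mG mB mB' Ba Bb' GB.
have : (P (~` G) <= (a + b)%:E)%E.
  apply: le_trans (_ : P (B `|` B') <= _)%E.
    by apply: le_measure; rewrite ?inE //; [exact: measurableC|exact: measurableU].
  by apply: le_trans (measureU2 _ _ _) _ => //; rewrite EFinD; exact: leeD.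
rewrite probability_setC //.
case: (P G) => [x| |] //=; last by rewrite leey.
by rewrite -EFinB !lee_fin; lra.
Qed.

End finite_unions.

(** Stated for any total order: the reversed one gives the nearest point of Q_r^- on the left, the
    usual one that of Q_r^+ on the right. *)
Lemma exists_extremum (T : eqType) (le : rel T) (r : seq T) (Q : T -> Prop) :
  total le -> transitive le -> (exists2 x, x \in r & Q x) ->
  exists x, [/\ x \in r, Q x & forall y, y \in r -> Q y -> le x y].
Proof.
move=> tot tr; elim: r => [[]//|a r IHr] [x xar Qx].
have [[y yr Qy]|noQ] := pselect (exists2 y, y \in r & Q y); last first.
  have ax : a = x.
    by move: xar; rewrite inE => /predU1P[//|xr]; case: noQ; exists x.
  exists a; split; [exact: mem_head | by rewrite ax | move=> y].
  rewrite inE => /predU1P[-> _|yr Qy]; first by have := tot a a; rewrite orbb.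
  by case: noQ; exists y.
have {y yr Qy}[y [yr Qy ymin]] :
    exists y, [/\ y \in r, Q y & forall z, z \in r -> Q z -> le y z].
  by apply: IHr; exists y.
have le_refl t : le t t by have := tot t t; rewrite orbb.
have [[Qa ay]|noa] := pselect (Q a /\ le a y).
  exists a; split=> //; first exact: mem_head.
  move=> t; rewrite inE => /predU1P[->//|tr' Qt].
  exact: tr ay (ymin _ tr' Qt).
exists y; split=> //; first by rewrite inE yr orbT.
move=> t; rewrite inE => /predU1P[-> Qa|]; last exact: ymin.
by have /orP[//|ay] := tot y a; case: noa.
Qed.

Section sampling_scheme_events.
Context {R : realType} {d : measure_display} {T : measurableType d}.
Variables (X : nat -> {mfun T >-> bool}) (P : R -> probability T R).
Hypothesis iidX : forall p : R, 0 < p < 1 -> iid_bernoulli (P p) X p.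
Variables eps delta zeta rho : R.
Hypotheses (eps01 : 0 < eps < 1) (delta01 : 0 < delta < 1).
Hypotheses (zeta0 : 0 < zeta) (rho0 : 0 < rho).
Hypothesis zeta_ln : ln (zeta * delta) <
  ((1 + eps + Num.sqrt (1 + 4 * eps + eps ^+ 2)) ^+ 2 / (4 * eps ^+ 2)
    + 1 / 2) * (eps / (1 + eps) - ln (1 + eps)).

Let s := stages eps delta zeta rho.
Let gam := gamma_ eps delta zeta rho.
Let z := z_ eps delta zeta rho.
Let ph l w : R := phat_ X eps delta zeta rho l w.
Let D := D_ X eps delta zeta rho.
Implicit Types (l : nat) (w : T) (c p q : R).

Let gam0 l : (0 < l <= s)%N -> (0 < gam l)%N.
Proof. exact: gamma_gt0. Qed.

Lemma stop_stageP w (l := stop_stage X eps delta zeta rho w) :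
  [/\ (0 < l <= s)%N, D l.-1 w = false & D l w = true].
Proof.
have hasD : has (fun l => D l w) (iota 1 s).
  apply/hasP; exists s; first by rewrite mem_iota stages_gt0 //= add1n ltnS leqnn.
  rewrite /D /D_ stages_gt0 //=; apply: le_trans (_ : 0 <= _).
    exact: z_last_le0.
  exact: sample_mean_ge0.
have := hasD; rewrite has_find size_iota => fs.
split=> //; last by have := nth_find 0%N hasD; rewrite nth_iota // add1n.
rewrite /l /stop_stage /=.
case iE : (find (fun l => D l w) (iota 1 s)) fs => [|i] fs; first by rewrite /D /D_.
have := before_find 0%N (a := fun l => D l w) (s := iota 1 s) (i := i).
by rewrite iE leqnn nth_iota ?add1n; [apply | exact: ltnW].
Qed.

(** * Measurability of the stopping and error events *)

Section fixed_parameter.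
Variable p : R.
Hypothesis p01 : 0 < p < 1.

Lemma measurable_successes (k n : nat) : measurable [set w | (k <= successes X n w)%N].
Proof.
rewrite (_ : [set w | _] = [set w | (k <= ones (word X n w))%N]).
  exact: (measurable_word (iidX p01) n (fun x => k <= ones x)%N).
by apply/seteqP; split=> w /=; rewrite ones_word.
Qed.

Lemma measurable_phat_ge c l : (0 < l <= s)%N -> measurable [set w | c <= ph l w].
Proof.
move=> ls; have [c0|c0] := ltP 0 c; last first.
  rewrite (_ : [set w | _] = setT) //; apply/seteqP; split=> w //= _.
  exact: le_trans c0 (sample_mean_ge0 _ _ _).
have [C hC] := last_le (gam l) c0.
rewrite (_ : [set w | _] = [set w | (gam l <= successes X C w)%N]).
  exact: measurable_successes.
by apply/seteqP; split=> w /=; rewrite /ph /phat_ (le_sample_mean X w c0 (gam0 ls) hC).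
Qed.

Lemma measurable_phat_gt c l : 0 < c -> (0 < l <= s)%N ->
  measurable [set w | c < ph l w].
Proof.
move=> c0 ls; have [M hM] := last_lt c0 (gam0 ls).
rewrite (_ : [set w | _] = [set w | (gam l <= successes X M w)%N]).
  exact: measurable_successes.
by apply/seteqP; split=> w /=; rewrite /ph /phat_ (lt_sample_mean X w c0 (gam0 ls) hM).
Qed.

Lemma measurable_D l : (l <= s)%N -> measurable [set w | D l w].
Proof.
case: l => [_|l ls]; last exact: measurable_phat_ge.
by rewrite (_ : [set w | _] = set0) //; apply/seteqP; split.
Qed.

Lemma measurable_stop l (Q : set T) : (0 < l <= s)%N -> measurable Q ->
  measurable [set w | [/\ Q w, D l.-1 w = false & D l w = true]].
Proof.
move=> ls mQ.
rewrite (_ : [set w | _] = Q `&` ~` [set w | D l.-1 w] `&` [set w | D l w]).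
  have /andP[_ ls'] := ls.
  apply: measurableI; last exact: measurable_D.
  apply: measurableI => //; apply/measurableC/measurable_D.
  exact: leq_trans (leq_pred l) ls'.
apply/seteqP; split=> w /= [].
  by move=> Qw -> ->.
by case=> Qw /negP/negbTE.
Qed.

Lemma measurable_stop_stage l :
  measurable [set w | stop_stage X eps delta zeta rho w = l].
Proof.
have mfind (r : seq nat) j : all (leq^~ s) r ->
    measurable [set w | find (fun i => D i w) r = j].
  elim: r j => [|i r IHr] j /=.
    case: j => [|j] _.
      by rewrite (_ : [set w | _] = setT) //; apply/seteqP; split.
    by rewrite (_ : [set w | _] = set0) //; apply/seteqP; split.
  move=> /andP[/measurable_D mDi rs].
  case: j => [|j].
    rewrite (_ : [set w | _] = [set w | D i w]) //.
    by apply/seteqP; split=> w /=; case: (D i w).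
  rewrite (_ : [set w | _] =
      ~` [set w | D i w] `&` [set w | find (fun i => D i w) r = j]).
    by apply: measurableI; [exact: measurableC | exact: IHr].
  apply/seteqP; split=> w /=; case: (D i w) => //.
  - by move=> [].
  - by case=> /(_ isT).
  - by move=> [_ ->].
case: l => [|l]; first by rewrite (_ : [set w | _] = set0) //; apply/seteqP; split.
rewrite (_ : [set w | _] =
    [set w | find (fun i => D i w) (iota 1 s) = l]).
  by apply/mfind/allP => i; rewrite mem_iota add1n ltnS => /andP[].
by apply/seteqP; split=> w /= => [[]|<-].
Qed.

Lemma relative_errorE x : (`|(x - p) / p| <= eps) =
  ((1 - eps) * p <= x) && ~~ ((1 + eps) * p < x).
Proof.
have [p0 _] := andP p01.
rewrite ler_norml ler_pdivlMr // ler_pdivrMr // -leNgt.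
by apply/andP/andP => -[? ?]; split; lra.
Qed.

Lemma measurable_accurate :
  measurable [set w | `|(phat X eps delta zeta rho w - p) / p| <= eps].
Proof.
have [p0 p1] := andP p01; have [e0 e1] := andP eps01.
pose good l := [set w | (1 - eps) * p <= ph l w] `&`
  ~` [set w | (1 + eps) * p < ph l w].
rewrite (_ : [set w | _] = \big[setU/set0]_(l <- iota 1 s)
    ([set w | stop_stage X eps delta zeta rho w = l] `&` good l)).
  rewrite big_seq; apply: bigsetU_measurable => l; rewrite mem_iota add1n ltnS => ls.
  apply: measurableI; first exact: measurable_stop_stage.
  apply: measurableI; first exact: measurable_phat_ge.
  apply: measurableC; apply: measurable_phat_gt => //.
  by rewrite mulr_gt0 //; lra.
apply/seteqP; split=> w /=.
  rewrite relative_errorE => /andP[h1 h2].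
  have [ls _ _] := stop_stageP w.
  apply: (@mem_bigsetU _ _ _ _ (stop_stage X eps delta zeta rho w)).
    by rewrite mem_iota add1n ltnS; exact: ls.
  by split=> //; split=> //; exact/negP.
move=> Uw; have [l [lw h1 h2]] : exists l, [/\ stop_stage X eps delta zeta rho w = l,
    (1 - eps) * p <= ph l w & ~ ((1 + eps) * p < ph l w)].
  move: Uw; elim: (iota 1 s) => [|l r IHr]; first by rewrite big_nil.
  rewrite big_cons => -[[lw [h1 h2]]|//]; by exists l.
rewrite relative_errorE /phat /stop_size lw.
by apply/andP; split; [|apply/negP].
Qed.

End fixed_parameter.
Lemma ones_take_word (m n : nat) w : (m <= n)%N ->
  ones (take m (word X n w)) = successes X m w.
Proof. by move=> mn; rewrite take_word // ones_word. Qed.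

(** The degenerate cases fit the same form with N = 0: D_0 = 0 always holds and takes k = gamma_1 >
    0, whereas a stage with nonpositive z never has D = 0 and takes k = 0. The bound k <= gamma_l
    settles D_(l-1) = 0 no later than the hitting time of gamma_l. *)
Lemma previous_stage_word l : (0 < l <= s)%N ->
  exists N k, (k <= gam l)%N /\
    forall w, D l.-1 w = false <-> (successes X N w < k)%N.
Proof.
case: l => [//|[|l]] /andP[_ ls].
  by exists 0%N, (gam 1); split=> // w; rewrite successes0 gam0.
have ls' : (0 < l.+1 <= s)%N by rewrite /= ltnW.
have [z0|z0] := ltP 0 (z l.+1); last first.
  exists 0%N, 0%N; split=> // w; rewrite /D /D_ /= (le_trans z0) //.
  exact: sample_mean_ge0.
have [N hN] := last_le (gam l.+1) z0.
exists N, (gam l.+1); split; first by apply/ltnW; exact: gamma_lt.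
move=> w; rewrite /D /D_ /= /phat_ -/(z _) (le_sample_mean X w z0 (gam0 ls') hN).
by rewrite ltnNge; split=> [->|/negbTE].
Qed.

Lemma prob_stop_low_le c p q l : 0 < c -> c <= q -> q <= p -> p < 1 -> (0 < l <= s)%N ->
  (P p [set w | [/\ (ph l w <= c)%R, D l.-1 w = false & D l w = true]] <=
   P q [set w | [/\ (ph l w <= c)%R, D l.-1 w = false & D l w = true]])%E.
Proof.
move=> c0 cq qp p1 ls.
have [M hM] := last_lt c0 (gam0 ls).
have [N' [k' [k'k hN']]] := previous_stage_word ls.
(* b is true exactly when z_l <= 0, where D_l = 1 even on paths with default estimate 0. *)
have [b [N hN]] : exists b N, forall w,
    (D l w = true) <-> b || (gam l <= successes X N w)%N.
  have l0 : (0 < l)%N by case/andP: ls.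
  have [z0|z0] := ltP 0 (z l).
    have [N hN] := last_le (gam l) z0; exists false, N => w.
    by rewrite /D /D_ l0 /= /phat_ (le_sample_mean X w z0 (gam0 ls) hN).
  exists true, 0%N => w; split=> // _; rewrite /D /D_ l0 /=.
  exact: le_trans z0 (sample_mean_ge0 _ _ _).
pose n := maxn M (maxn N N').
have [Mn Nn N'n] : [/\ M <= n, N <= n & N' <= n]%N by rewrite /n !leq_max !leqnn !orbT.
pose E x := [&& ones (take M x) < gam l, b || (gam l <= ones (take N x)) &
                ones (take N' x) < k']%N.
have -> : [set w | [/\ ph l w <= c, D l.-1 w = false & D l w = true]] =
    [set w | E (word X n w)].
  apply/seteqP; split=> w /=; rewrite /E !ones_take_word // leNgt.
    rewrite /ph /phat_ (lt_sample_mean X w c0 (gam0 ls) hM) -ltnNge.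
    by move=> [h1 /hN' h2 /hN h3]; apply/and3P.
  move=> /and3P[h1 /hN h3 /hN' h2]; split=> //.
  by rewrite /ph /phat_ (lt_sample_mean X w c0 (gam0 ls) hM) -ltnNge.
have p01 : 0 < p < 1 by apply/andP; split; lra.
have q01 : 0 < q < 1 by apply/andP; split; lra.
rewrite (prob_word (iidX p01)) (prob_word (iidX q01)).
rewrite lee_fin; apply: (@word_prob_late_le _ p q c n _ M b N k' N') => //.
- exact: ltW.
- by case/andP: q01.
- by rewrite leNgt hM ltnn.
Qed.

Lemma prob_stop_up_le c p q l : 0 < p -> p <= q -> q < 1 -> q <= c -> (0 < l <= s)%N ->
  (P p [set w | [/\ (c <= ph l w)%R, D l.-1 w = false & D l w = true]] <=
   P q [set w | [/\ (c <= ph l w)%R, D l.-1 w = false & D l w = true]])%E.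
Proof.
move=> p0 pq q1 qc ls.
(* An overestimate and D_l = 1 are both lower bounds on the estimate, so they merge into one
   threshold. *)
pose c' := Num.max c (z l).
have c'0 : 0 < c' by rewrite lt_max (lt_le_trans p0) ?(le_trans pq).
have [C hC] := last_le (gam l) c'0.
have [N' [k' [k'k hN']]] := previous_stage_word ls.
pose n := maxn C N'.
have [Cn N'n] : (C <= n)%N /\ (N' <= n)%N by rewrite /n !leq_max !leqnn !orbT.
pose E x := ((gam l <= ones (take C x)) && (ones (take N' x) < k'))%N.
have -> : [set w | [/\ c <= ph l w, D l.-1 w = false & D l w = true]] =
    [set w | E (word X n w)].
  have phE w : (c <= ph l w) && D l w = (gam l <= successes X C w)%N.
    rewrite -(le_sample_mean X w c'0 (gam0 ls) hC) ge_max.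
    by case/andP: ls => l0 _; rewrite /D /D_ l0.
  apply/seteqP; split=> w /=; rewrite /E !ones_take_word // -phE.
    by move=> [-> /hN' -> ->].
  by move=> /andP[/andP[-> ->] /hN' ->].
have p01 : 0 < p < 1 by apply/andP; split; lra.
have q01 : 0 < q < 1 by apply/andP; split; lra.
rewrite (prob_word (iidX p01)) (prob_word (iidX q01)).
rewrite lee_fin; apply: (@word_prob_early_le _ p q c' n _ C k' N') => //.
- exact: ltW.
- by rewrite /c' le_max qc.
- by rewrite hC.
Qed.

Lemma prob_stage_le l p : (0 < l <= s)%N -> 0 < p -> p < z l ->
  (P p [set w | D l w] <=
   (expR ((gam l)%:R / z l * massart_exponent (z l) p))%:E)%E.
Proof.
move=> ls p0 pz.
have z0 : 0 < z l by exact: lt_trans pz.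
have z1 : z l <= 1 by exact: z_le1.
have p01 : 0 < p < 1 by rewrite p0 (lt_le_trans pz).
have [N hN] := last_le (gam l) z0.
have -> : [set w | D l w] = [set w | (gam l <= ones (word X N w))%N].
  apply/seteqP; split=> w /=; case/andP: (ls) => l0 _;
    by rewrite /D /D_ l0 /= /phat_ (le_sample_mean X w z0 (gam0 ls) hN) ones_word.
rewrite (prob_word (iidX p01) N (fun x => gam l <= ones x)%N) lee_fin.
by apply: word_prob_massart; rewrite ?hN.
Qed.

Let gs : R := (gam s)%:R.

Let s_in : (0 < s <= s)%N.
Proof. by rewrite stages_gt0 //=. Qed.

Let gs_gt0 : 0 < gs.
Proof. by rewrite ltr0n gam0. Qed.

(** gs eps / (1 + eps) is the distance from gs to the Poisson mean gs / (1 + eps). The other mean,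
    gs / (1 - eps), is farther still. *)
Let gs_dev : gs <= (gs * eps / (1 + eps)) ^+ 2.
Proof.
have [e0 e1] := andP eps01.
have h : ((1 + eps) / eps) ^+ 2 <= gs by exact: gamma_last_large.
have -> : (gs * eps / (1 + eps)) ^+ 2 = gs * (gs * ((1 + eps) / eps) ^- 2).
  by move: gs gs_gt0 => a a0; field; lra.
rewrite ler_peMr ?(ltW gs_gt0) // ler_pdivlMr ?mul1r //.
by rewrite exprn_gt0 // divr_gt0 //; lra.
Qed.

Lemma prob_last_low_le p : 0 < p < 1 ->
  (P p [set w | (ph s w < (1 - eps) * p)%R] <=
   (poisson_cdf (gam s) (gs / (1 - eps)))%:E)%E.
Proof.
move=> p01; have [p0 p1] := andP p01; have [e0 e1] := andP eps01.
have c0 : 0 < (1 - eps) * p by rewrite mulr_gt0 //; lra.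
have [C hC] := last_le (gam s) c0.
have -> : [set w | ph s w < (1 - eps) * p] = [set w | (ones (word X C w) < gam s)%N].
  by apply/seteqP; split=> w /=;
    rewrite ltNge /ph /phat_ (le_sample_mean X w c0 (gam0 s_in) hC) ones_word ltnNge.
rewrite (prob_word (iidX p01) C (fun x => ones x < gam s)%N) lee_fin.
rewrite word_prob_ones_lt.
(* C is the last n with (1 - eps) p n <= gs, so only C + 1 is known to pass; hence the mean (n + 1)
   p in [binomial_cdf_le_poisson]. *)
have lamC : gs / (1 - eps) <= C.+1%:R * p.
  rewrite ler_pdivrMr; last lra.
  have : ~~ ((1 - eps) * p * C.+1%:R <= gs) by rewrite hC ltnn.
  by rewrite -ltNge; lra.
have dev0 : 0 <= gs * eps / (1 + eps).
  by rewrite divr_ge0 ?mulr_ge0 ?(ltW gs_gt0) //; lra.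
have lam_dev : gs + gs * eps / (1 + eps) <= gs / (1 - eps).
  rewrite -subr_ge0.
  have -> : gs / (1 - eps) - (gs + gs * eps / (1 + eps)) =
      2 * gs * eps ^+ 2 / ((1 - eps) * (1 + eps)).
    by move: gs => a; field; lra.
  by rewrite divr_ge0 ?mulr_ge0 ?sqr_ge0 ?(ltW gs_gt0) //; lra.
apply: le_trans (binomial_cdf_le_poisson p01 _ _) _; rewrite -/gs.
- by lra.
- apply: le_trans gs_dev _; rewrite ler_sqr ?nnegrE //; lra.
- by apply: poisson_cdf_nonincreasing => //; rewrite divr_ge0 ?(ltW gs_gt0) //; lra.
Qed.

Lemma prob_last_up_le p : 0 < p < 1 ->
  (P p [set w | ((1 + eps) * p < ph s w)%R] <=
   (1 - poisson_cdf (gam s) (gs / (1 + eps)))%:E)%E.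
Proof.
move=> p01; have [p0 p1] := andP p01; have [e0 e1] := andP eps01.
have c0 : 0 < (1 + eps) * p by rewrite mulr_gt0 //; lra.
have [M hM] := last_lt c0 (gam0 s_in).
have -> : [set w | (1 + eps) * p < ph s w] = [set w | ~~ (ones (word X M w) < gam s)%N].
  by apply/seteqP; split=> w /=;
    rewrite /ph /phat_ (lt_sample_mean X w c0 (gam0 s_in) hM) ones_word -leqNgt.
rewrite (prob_word (iidX p01) M (fun x => ~~ (ones x < gam s)%N)) lee_fin.
rewrite word_probC word_prob_ones_lt lerD2l lerN2.
have lamM : M%:R * p <= gs / (1 + eps).
  rewrite ler_pdivlMr; last lra.
  have : (1 + eps) * p * M%:R < gs by rewrite hM.
  by lra.
have lam_dev : gs / (1 + eps) = gs - gs * eps / (1 + eps).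
  by move: gs => a; field; lra.
have dev0 : 0 <= gs * eps / (1 + eps).
  by rewrite divr_ge0 ?mulr_ge0 ?(ltW gs_gt0) //; lra.
apply: le_trans (binomial_cdf_ge_poisson p01 _ _); rewrite -/gs.
- by apply: poisson_cdf_nonincreasing => //; rewrite mulr_ge0 // ltW.
- by lra.
- apply: le_trans gs_dev _; rewrite -[leRHS]sqrrN ler_sqr ?nnegrE //; lra.
Qed.

Hypothesis zeta_g : g eps (gam s) < delta.

Let gE : g eps (gam s) =
  1 - poisson_cdf (gam s) (gs / (1 + eps)) + poisson_cdf (gam s) (gs / (1 - eps)).
Proof. by []. Qed.

Let lower_tail_le : poisson_cdf (gam s) (gs / (1 - eps)) <= delta / 2.
Proof.
have [e0 e1] := andP eps01.
suff : poisson_cdf (gam s) (gs / (1 - eps)) <= 1 - poisson_cdf (gam s) (gs / (1 + eps)).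
  by have := zeta_g; rewrite gE; lra.
(* Reflection at y = 1 - eps gives the upper tail at gs (1 - eps), which is at most gs / (1 + eps)
   because (1 - eps) (1 + eps) <= 1. *)
have e01 : 0 < 1 - eps <= 1 by apply/andP; split; lra.
have := poisson_cdf_reflect (gam s).-1 e01; rewrite prednK ?gam0 // -/gs.
move=> /le_trans; apply; rewrite lerD2l lerN2.
apply: poisson_cdf_nonincreasing; first by rewrite mulr_ge0 ?(ltW gs_gt0) //; lra.
by rewrite ler_pM2l // -[leRHS]mul1r ler_pdivlMr; nra.
Qed.

Variable pstar : R.
Hypothesis pstarP : is_pstar eps delta zeta rho pstar.

Let pstar_lt_z l : (0 < l < s)%N -> pstar < z l.
Proof.
move=> /andP[l0 ls]; have [/andP[_ h] _] := pstarP; apply: lt_le_trans h _.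
by apply: z_antitone => //; rewrite ?leq_pred // -ltnS (ltn_predK ls).
Qed.

Lemma accurate_below_pstar p : 0 < p -> p <= pstar -> p < 1 ->
  ((1 - delta)%:E <=
   P p [set w | (`|(phat X eps delta zeta rho w - p) / p| <= eps)%R])%E.
Proof.
move=> p0 ppstar p1; have p01 : 0 < p < 1 by rewrite p0.
have [e0 e1] := andP eps01.
have [/andP[pstar0 pstarz] pstarE] := pstarP.
rewrite pstar_lhsE in pstarE.
set S := \sum_(1 <= l < s) _ in pstarE.
have deltaE : delta = (poisson_cdf (gam s) (gs / (1 - eps)) +
   (1 - poisson_cdf (gam s) (gs / (1 + eps)))) + S.
  by rewrite -pstarE gE; ring.
rewrite [X in ((1 - X)%:E <= _)%E]deltaE {deltaE}.
pose G := [set w | ph s w < (1 - eps) * p] `|` [set w | (1 + eps) * p < ph s w].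
have mlow : measurable [set w | ph s w < (1 - eps) * p].
  rewrite (_ : [set w | _] = ~` [set w | (1 - eps) * p <= ph s w]).
    by apply: measurableC; exact: (measurable_phat_ge p01 ((1 - eps) * p) s_in).
  by apply/seteqP; split=> w /=; rewrite ltNge => /negP.
have mup : measurable [set w | (1 + eps) * p < ph s w].
  have c0 : 0 < (1 + eps) * p by rewrite mulr_gt0 //; lra.
  exact: (measurable_phat_gt p01 c0 s_in).
have mD l : (0 < l < s)%N -> measurable [set w | D l w].
  by move=> /andP[_ ls]; exact: (measurable_D p01 (ltnW ls)).
pose A l := if (0 < l < s)%N then [set w | D l w] else set0.
have mA l : measurable (A l) by rewrite /A; case: ifP => // /mD.
apply: (@prob_ge_of_cover _ _ _ _ _ G (\big[setU/set0]_(1 <= l < s) A l)).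
- exact: (measurable_accurate p01).
- exact: measurableU.
- exact: bigsetU_measurable.
- apply: le_trans (measureU2 _ _ _) _ => //; rewrite EFinD.
  by apply: leeD; [exact: prob_last_low_le | exact: prob_last_up_le].
- apply: le_trans (prob_bigsetU_le _ _ mA) _; rewrite /S -sumEFin.
  rewrite big_nat_cond [leRHS]big_nat_cond.
  apply: lee_sum => l; rewrite andbT => ls; rewrite /A ls.
  have ls' : (0 < l <= s)%N by case/andP: ls => -> /ltnW.
  apply: le_trans (prob_stage_le ls' p0 (le_lt_trans ppstar (pstar_lt_z ls))) _.
  rewrite lee_fin; move: ppstar; rewrite le_eqVlt => /predU1P[->//|ppstar].
  by apply/ltW/pstar_exponent_increasing.
move=> w /=; rewrite relative_errorE // => /negP; rewrite negb_and negbK -ltNge.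
have [/andP[l0]] := stop_stageP w; rewrite leq_eqVlt => /predU1P[lE|ls] _ Dl.
  by rewrite /phat /stop_size lE => /orP[h|h]; left; [left|right].
move=> _; right; apply: (@mem_bigsetU _ _ _ _ (stop_stage X eps delta zeta rho w)).
  by rewrite mem_index_iota l0.
by rewrite /A l0 ls.
Qed.

Let pstar0 : 0 < pstar.
Proof. by have [/andP[]] := pstarP. Qed.

(** A point above pstar has pstar c m < gamma_l <= gamma_s, which bounds m. So the set is finite and
    nearest points exist. *)
Let Qr_in_seq c : 0 < c -> exists r : seq R, forall q,
  Qr eps delta zeta rho pstar c q -> q \in r.
Proof.
move=> c0; have pc0 : 0 < pstar * c by rewrite mulr_gt0.
have [M hM] := last_lt pc0 (gam0 s_in).
exists [seq (gam l)%:R / (m%:R * c) | l <- iota 1 s, m <- iota 1 M].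
move=> q [l ls [/andP[qp _] [m m0 qE]]]; rewrite qE.
apply: allpairs_f; first by rewrite mem_iota add1n ltnS; exact: ls.
rewrite mem_iota m0 add1n ltnS -hM.
move: qp; rewrite qE ltr_pdivlMr ?mulr_gt0 ?ltr0n // => h.
apply: lt_le_trans (_ : (gam l)%:R <= _); first by rewrite -mulrA (mulrC c).
by rewrite ler_nat; have /andP[l0 ls'] := ls; exact: gamma_le.
Qed.

Let phat_valueP l w : (0 < l <= s)%N -> ph l w = 0 \/
  ph l w <= 1 /\ exists2 m : nat, (0 < m)%N & ph l w = (gam l)%:R / m%:R.
Proof.
move=> ls; have [[phE _]|[m [m0 phE hm]]] := @sample_meanP R _ _ X _ w (gam0 ls).
  by left; exact: phE.
right; split; last by exists m => //; exact: phE.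
rewrite /ph /phat_ phE ler_pdivrMr ?ltr0n // mul1r ler_nat.
apply: leq_trans (_ : successes X m w <= _)%N; first by rewrite -hm.
by rewrite -ones_word; apply: leq_trans (count_size _ _) _; rewrite size_word.
Qed.

(** * Parameters above p^*: reduction to the nearest points of Q_r^- and Q_r^+ *)

Section above_pstar.
Variable p : R.
Hypotheses (pstar_p : pstar < p) (p1 : p < 1).

Let low c l := [set w | [/\ ph l w <= c, D l.-1 w = false & D l w = true]].
Let up c l := [set w | [/\ c <= ph l w, D l.-1 w = false & D l w = true]].

Let p01 : 0 < p < 1.
Proof. by rewrite p1 (lt_trans pstar0). Qed.

Hypothesis low_Qr : forall q, Qr eps delta zeta rho pstar (1 - eps) q ->
  (\sum_(1 <= l < s.+1) P q (low ((1 - eps) * q) l) <= (delta / 2)%:E)%E.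

Lemma prob_low_above_pstar :
  (\sum_(1 <= l < s.+1) P p [set w | [/\ (ph l w < (1 - eps) * p)%R,
      D l.-1 w = false & D l w = true]] <= (delta / 2)%:E)%E.
Proof.
have [e0 e1] := andP eps01; have c0 : 0 < 1 - eps by lra.
have mlow l : (0 < l <= s)%N ->
    measurable [set w | [/\ ph l w < (1 - eps) * p, D l.-1 w = false & D l w = true]].
  move=> ls; apply: (measurable_stop p01 ls).
  rewrite (_ : (fun w => _) = ~` [set w | (1 - eps) * p <= ph l w]).
    by apply: measurableC; exact: (measurable_phat_ge p01 ((1 - eps) * p) ls).
  by apply/seteqP; split=> w /=; rewrite ltNge => /negP.
(* Q_r^- is made of the possible values of phat_l / (1 - eps). With a its greatest point below p, an
   estimate below (1 - eps) p is therefore at most (1 - eps) a. *)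
have near_value l w : (0 < l <= s)%N -> 0 < ph l w -> ph l w < (1 - eps) * p ->
    ph l w / (1 - eps) <= pstar \/
    Qr eps delta zeta rho pstar (1 - eps) (ph l w / (1 - eps)) /\
    ph l w / (1 - eps) < p.
  move=> ls ph0 phl; have [pp|pp] := lerP (ph l w / (1 - eps)) pstar; first by left.
  right; have qp : ph l w / (1 - eps) < p by rewrite ltr_pdivrMr // mulrC.
  split=> //; exists l => //=; split; first by rewrite pp (lt_trans qp).
  have [phE|[_ [m m0 phE]]] := phat_valueP w ls; first by rewrite phE ltxx in ph0.
  by exists m; rewrite // phE invfM mulrA.
have [[a [aQ ap] amax]|noQ] := pselect (exists2 a,
    Qr eps delta zeta rho pstar (1 - eps) a /\ a < p &
    forall q, Qr eps delta zeta rho pstar (1 - eps) q -> q < p -> q <= a).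
  apply: le_trans (low_Qr aQ).
  have pstar_a : pstar < a by case: aQ => ? _ [/andP[]].
  have a0 : 0 < a by exact: lt_trans pstar_a.
  have ca0 : 0 < (1 - eps) * a by rewrite mulr_gt0.
  rewrite big_nat_cond [leRHS]big_nat_cond.
  apply: lee_sum => l; rewrite andbT ltnS => ls.
  apply: le_trans (prob_stop_low_le ca0 _ (ltW ap) p1 ls); last by nra.
  apply: le_measure; rewrite ?inE; first exact: mlow.
    apply: (measurable_stop p01 ls).
    rewrite (_ : (fun w => _) = ~` [set w | (1 - eps) * a < ph l w]).
      by apply: measurableC; exact: (measurable_phat_gt p01 ca0 ls).
    by apply/seteqP; split=> w /=; rewrite leNgt => /negP.
  move=> w [phl D0 D1]; split=> //.
  have [ph0|ph0] := lerP (ph l w) 0; first exact: le_trans ph0 (ltW ca0).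
  rewrite mulrC -ler_pdivrMr //.
  have [h|[h1 h2]] := near_value l w ls ph0 phl; last exact: amax.
  exact: le_trans h (ltW pstar_a).
(* With no point of Q_r^- between [pstar] and [p], an underestimate is already
   below [(1 - eps) * pstar], which is less than every [z_l] with [l < s]. *)
have gap q : Qr eps delta zeta rho pstar (1 - eps) q -> q < p -> False.
  move=> qQ qp; apply: noQ; have [r hr] := Qr_in_seq c0.
  have [a [_ [aQ ap] amax]] := @exists_extremum _ (fun x y : R => y <= x) r
    (fun q => Qr eps delta zeta rho pstar (1 - eps) q /\ q < p)
    (fun x y => le_total y x) (fun y x t xy yt => le_trans yt xy)
    (ex_intro2 _ _ q (hr q qQ) (conj qQ qp)).
  by exists a => // t tQ tp; apply: amax => //; exact: hr.
rewrite big_nat_recr /=; last by case/andP: s_in.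
rewrite big_nat_cond big1 ?add0e => [|l /andP[ls _]].
  apply: le_trans (_ : (P p [set w | (ph s w < (1 - eps) * p)%R] <= _)%E); last first.
    by apply: le_trans (prob_last_low_le p01) _; rewrite lee_fin; exact: lower_tail_le.
  apply: le_measure; rewrite ?inE; first exact: mlow.
    rewrite (_ : [set w | _] = ~` [set w | (1 - eps) * p <= ph s w]).
      by apply: measurableC; exact: (measurable_phat_ge p01 ((1 - eps) * p) s_in).
    by apply/seteqP; split=> w /=; rewrite ltNge => /negP.
  by move=> w [].
rewrite (_ : [set w | _] = set0) ?measure0 //; apply/seteqP; split=> // w [phl _ D1].
have /andP[l0 ls'] := ls; have lls : (0 < l <= s)%N by rewrite l0 ltnW.
have zph : z l <= ph l w by move: D1; rewrite /D /D_ l0.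
have pph := lt_le_trans (pstar_lt_z ls) zph.
have ph0 : 0 < ph l w by exact: lt_trans pph.
have [h|[h1 h2]] := near_value l w lls ph0 phl; last exact: gap h1 h2.
by move: h; rewrite ler_pdivrMr //; nra.
Qed.

Hypothesis up_Qr : forall q, Qr eps delta zeta rho pstar (1 + eps) q ->
  (\sum_(1 <= l < s.+1) P q (up ((1 + eps) * q) l) <= (delta / 2)%:E)%E.

Lemma prob_up_above_pstar :
  (\sum_(1 <= l < s.+1) P p [set w | [/\ ((1 + eps) * p < ph l w)%R,
      D l.-1 w = false & D l w = true]] <= (delta / 2)%:E)%E.
Proof.
have [p0 _] := andP p01.
have [e0 e1] := andP eps01; have c0 : 0 < 1 + eps by lra.
have cp0 : 0 < (1 + eps) * p by rewrite mulr_gt0.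
have near_value l w : (0 < l <= s)%N -> (1 + eps) * p < ph l w ->
    Qr eps delta zeta rho pstar (1 + eps) (ph l w / (1 + eps)) /\
    p < ph l w / (1 + eps).
  move=> ls phl; have qp : p < ph l w / (1 + eps) by rewrite ltr_pdivlMr // mulrC.
  have [phE|[ph1 [m m0 phE]]] := phat_valueP w ls.
    by move: phl; rewrite phE ltNge ltW.
  split=> //; exists l => //=; split; last by exists m; rewrite // phE invfM mulrA.
  by rewrite (lt_trans pstar_p) //= ltr_pdivrMr // mul1r (le_lt_trans ph1) // ltrDl.
(* Since phat_l <= 1, every overestimate yields a point of Q_r^+ above p; if there is none, the
   event is empty. *)
have [[q [qQ pq]]|noQ] := pselect
  (exists q, Qr eps delta zeta rho pstar (1 + eps) q /\ p < q); last first.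
  rewrite big_nat_cond big1 ?lee_fin ?divr_ge0 // => [|l /andP[ls _]].
    by case/andP: delta01 => /ltW.
  rewrite (_ : [set w | _] = set0) ?measure0 //; apply/seteqP; split=> // w [phl _ _].
  by apply: noQ; exists (ph l w / (1 + eps)); exact: near_value.
have [r hr] := Qr_in_seq c0.
have [b [_ [bQ pb] bmin]] := @exists_extremum _ (fun x y : R => x <= y) r
  (fun q => Qr eps delta zeta rho pstar (1 + eps) q /\ p < q)
  (@le_total _ R) (@le_trans _ R) (ex_intro2 _ _ q (hr q qQ) (conj qQ pq)).
have b1 : b < 1 by case: bQ => ? _ [/andP[]].
apply: le_trans (up_Qr bQ).
rewrite big_nat_cond [leRHS]big_nat_cond.
apply: lee_sum => l; rewrite andbT ltnS => ls.
apply: le_trans (prob_stop_up_le p0 (ltW pb) b1 _ ls); last by nra.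
apply: le_measure; rewrite ?inE.
- apply: (measurable_stop p01 ls); exact: (measurable_phat_gt p01 cp0 ls).
- apply: (measurable_stop p01 ls).
  exact: (measurable_phat_ge p01 ((1 + eps) * b) ls).
move=> w [phl D0 D1]; split=> //.
have [h1 h2] := near_value l w ls phl.
by rewrite mulrC -ler_pdivlMr //; apply: bmin => //; exact: hr.
Qed.

Lemma accurate_above_pstar : ((1 - delta)%:E <=
   P p [set w | (`|(phat X eps delta zeta rho w - p) / p| <= eps)%R])%E.
Proof.
have [p0 _] := andP p01; have [e0 e1] := andP eps01.
pose A l := if (0 < l <= s)%N then [set w | [/\ ph l w < (1 - eps) * p,
  D l.-1 w = false & D l w = true]] else set0.
pose B l := if (0 < l <= s)%N then [set w | [/\ (1 + eps) * p < ph l w,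
  D l.-1 w = false & D l w = true]] else set0.
have mA l : measurable (A l).
  rewrite /A; case: ifP => // ls; apply: (measurable_stop p01 ls).
  rewrite (_ : (fun w => _) = ~` [set w | (1 - eps) * p <= ph l w]).
    by apply: measurableC; exact: (measurable_phat_ge p01 ((1 - eps) * p) ls).
  by apply/seteqP; split=> w /=; rewrite ltNge => /negP.
have mB l : measurable (B l).
  rewrite /B; case: ifP => // ls; apply: (measurable_stop p01 ls).
  by apply: (measurable_phat_gt p01 _ ls); rewrite mulr_gt0 //; lra.
have -> : 1 - delta = 1 - (delta / 2 + delta / 2) by field.
apply: (@prob_ge_of_cover _ _ _ _ _ (\big[setU/set0]_(1 <= l < s.+1) A l)
  (\big[setU/set0]_(1 <= l < s.+1) B l)).
- exact: (measurable_accurate p01).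
- exact: bigsetU_measurable.
- exact: bigsetU_measurable.
- apply: le_trans (prob_bigsetU_le _ _ mA) _; apply: le_trans prob_low_above_pstar.
  rewrite big_nat_cond [leRHS]big_nat_cond.
  by apply: lee_sum => l; rewrite andbT ltnS => ls; rewrite /A ls.
- apply: le_trans (prob_bigsetU_le _ _ mB) _; apply: le_trans prob_up_above_pstar.
  rewrite big_nat_cond [leRHS]big_nat_cond.
  by apply: lee_sum => l; rewrite andbT ltnS => ls; rewrite /B ls.
move=> w /=; rewrite relative_errorE // => /negP; rewrite negb_and negbK -ltNge.
have [ls D0 D1] := stop_stageP w.
have lr : stop_stage X eps delta zeta rho w \in index_iota 1 s.+1.
  by rewrite mem_index_iota ltnS; exact: ls.
by move=> /orP[h|h]; [left|right]; apply: (mem_bigsetU lr); rewrite /A /B ls.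
Qed.

End above_pstar.

End sampling_scheme_events.

Theorem theorem3 (R : realType) (d : measure_display) (T : measurableType d)
    (X : nat -> {mfun T >-> bool}) (P : R -> probability T R)
    (iidX : forall p : R, 0 < p < 1 -> iid_bernoulli (P p) X p)
    (eps delta zeta rho : R)
    (eps01 : 0 < eps < 1) (delta01 : 0 < delta < 1)
    (zeta0 : 0 < zeta) (rho0 : 0 < rho)
    (s := stages eps delta zeta rho)
    (gamma := gamma_ eps delta zeta rho)
    (phat_l := phat_ X eps delta zeta rho)
    (D := D_ X eps delta zeta rho)
    (zeta_g : g eps (gamma s) < delta)
    (zeta_ln : ln (zeta * delta) <
      ((1 + eps + Num.sqrt (1 + 4 * eps + eps ^+ 2)) ^+ 2 / (4 * eps ^+ 2)
        + 1 / 2) * (eps / (1 + eps) - ln (1 + eps)))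
    (pstar : R) (pstarP : is_pstar eps delta zeta rho pstar) :
  (forall q : R, is_pstar eps delta zeta rho q -> q = pstar) /\
  ((forall p : R, Qr eps delta zeta rho pstar (1 - eps) p ->
      (\sum_(1 <= l < s.+1)
         P p [set w | [/\ (phat_l l w <= (1 - eps) * p)%R,
                          D l.-1 w = false & D l w = true]]
       <= (delta / 2)%:E)%E) ->
   (forall p : R, Qr eps delta zeta rho pstar (1 + eps) p ->
      (\sum_(1 <= l < s.+1)
         P p [set w | [/\ ((1 + eps) * p <= phat_l l w)%R,
                          D l.-1 w = false & D l w = true]]
       <= (delta / 2)%:E)%E) ->
   forall p : R, 0 < p < 1 ->
     ((1 - delta)%:E <=
      P p [set w | (`|(phat X eps delta zeta rho w - p) / p| <= eps)%R])%E).
Proof.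
split=> [q qP|low_Qr up_Qr p /andP[p0 p1]].
  exact (pstar_unique eps01 delta01 zeta0 rho0 zeta_ln qP pstarP).
have [ppstar|pstarp] := lerP p pstar.
  exact (accurate_below_pstar iidX eps01 delta01 zeta0 rho0 zeta_ln pstarP
           p0 ppstar p1).
exact (accurate_above_pstar iidX eps01 delta01 zeta0 rho0 zeta_ln zeta_g pstarP
         pstarp p1 low_Qr up_Qr).
Qed.
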